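(* Let $\rho=\lambda-(\sup(p_0)-\inf(p_0))$. Suppose that $\rho>0$ and that $$\sup_{i\in F^*}\sum_{j\in F^*,\,j\ne i}Q_{i,j}<+\infty\quad\text{and}\quad \sup_{i\in F^*}p_0(i)<+\infty.$$ Then there exist constants $K_0,\gamma>0$, not depending on $N$, such that for every $N\ge2$ and every $\eta\in E^{(N)}$, $$\sup_{t\ge0}\ \sup_{\|\varphi\|_\infty\le1}\mathbb{E}_\eta\big[\,|m(\eta_t)(\varphi)-m(\eta)T_t\varphi|\,\big]\le\frac{K_0}{N^\gamma},$$ where the inner supremum is over functions $\varphi:F^*\to\mathbb{R}$ with $\|\varphi\|_\infty\le1$ and $(\eta_t)_{t\ge0}$ is the Fleming-Viot process with $N$ particles.
   Context: $F^*$ is a (finite or infinite) countable discrete set, and $(Q_{i,j})_{i,j\in F^*}$ is the transition rate matrix of an irreducible, positive recurrent continuous-time Markov process on $F^*$. The function $p_0:F^*\to[0,\infty)$ (death rate) is not identically zero; $\sup(p_0),\inf(p_0)$ are taken over $F^*$. $F=F^*\cup\{0\}$ with $0\notin F^*$. The parameter $\lambda$ is $$\lambda=\inf_{i,i'\in F^*,\,i\ne i'}\Big(Q_{i,i'}+Q_{i',i}+\sum_{j\ne i,i'}Q_{i,j}\wedge Q_{i',j}\Big).$$ Conditioned semigroup: let $(P_t)_{t\ge0}$ be the semigroup on $F$ of the Markov process with generator $Gf(i)=p_0(i)(f(0)-f(i))+\sum_{j\in F^*}Q_{i,j}(f(j)-f(i))$ for $i\in F^*$ and $Gf(0)=0$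 (so $0$ is absorbing). For a probability measure $\mu$ on $F^*$, $\mu T_t$ is the law at time $t$ of this process started from $\mu$ and conditioned on non-absorption up to time $t$: for $f$ on $F^*$, with the convention $f(0)=0$, $$\mu T_t f=\frac{\sum_{y\in F^*}P_tf(y)\mu(y)}{\sum_{y\in F^*}P_t\mathbf{1}_{\{0\}^c}(y)\mu(y)}.$$ Fleming-Viot process: for an integer $N\ge2$, $E=E^{(N)}=\{\eta:F^*\to\mathbb{N}:\sum_{i\in F^*}\eta(i)=N\}$. $T_{i\to j}\eta$ is obtained from $\eta$ by decreasing $\eta(i)$ by 1 and increasing $\eta(j)$ by 1 (when $\eta(i)\ne0$). The Fleming-Viot process $(\eta_t)_{t\ge0}$ with $N$ particles is the Markov process on $E$ with generator $$\mathcal{L}f(\eta)=\sum_{i\in F^*}\eta(i)\sum_{j\in F^*}\big(f(T_{i\to j}\eta)-f(\eta)\big)\Big(Q_{i,j}+p_0(i)\frac{\eta(j)}{N-1}\Big).$$ $\mathbb{E}_\eta$ denotes expectation given $\eta_0=\eta$. The empirical distribution is $m(\eta)=\frac1N\sum_{k\in F^*}\eta(k)\delta_{\{k\}}$ and $m(\eta)(\varphi)=\sum_{j\in F^*}\varphi(j)m(\eta)(\{j\})$. *)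

(* Defs.v *)
From HB Require Import structures.
From mathcomp Require Import all_boot all_order all_algebra.
From mathcomp Require Import finmap.
From mathcomp Require Import all_classical all_reals all_analysis.
Import Order.TTheory GRing.Theory Num.Theory.
Import numFieldNormedType.Exports.

Set Implicit Arguments.
Unset Strict Implicit.
Unset Printing Implicit Defensive.

Local Open Scope classical_set_scope.
Local Open Scope ring_scope.

(* The sum of an absolutely summable real family, i.e. its integral against
   the counting measure; [\esum] alone only handles nonnegative families. *)
Definition rsum (R : realType) (S : choiceType) (f : S -> R) : R :=
  fine (\esum_(x in [set: S]) (EFin \o f)^\+ x -
        \esum_(x in [set: S]) (EFin \o f)^\- x)%E.

Section continuous_time_markov_processes.
Variables (R : realType) (S : choiceType).
Implicit Types (p : R -> S -> S -> R) (G : (S -> R) -> (S -> R)).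

(* Only the values [p t] for [0 <= t] matter. *)
Record transition_function p : Prop := TransitionFunction {
  transition_ge0 : forall t x y, 0 <= t -> 0 <= p t x y;
  transition_sum1 : forall t x, 0 <= t ->
    (\esum_(y in [set: S]) (p t x y)%:E = 1)%E;
  transition_0 : forall x y, p 0 x y = (x == y)%:R;
  transition_chapman_kolmogorov : forall s t x z, 0 <= s -> 0 <= t ->
    p (s + t) x z = rsum (fun y => p s x y * p t y z) }.

(* The semigroup [P_t f (x) = \sum_y p_t(x, y) f(y)] on bounded functions. *)
Definition semigroup p (t : R) (f : S -> R) (x : S) : R :=
  rsum (fun y => p t x y * f y).

(* [G] is the (pointwise) derivative at [0] of the semigroup, on bounded
   functions; applied to indicators of points, this says that the entries
   of [p] have the jump rates of [G] as right derivatives at [0]. *)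
Definition has_generator p G : Prop :=
  forall (f : S -> R), (exists M, forall x, `|f x| <= M) ->
  forall x, (fun t => (semigroup p t f x - f x) / t) @ 0^'+ --> G f x.

Definition transition_function_of G p : Prop :=
  transition_function p /\ has_generator p G.

(* Right-continuous processes (for the discrete topology on [S]) whose
   finite-dimensional distributions are given by [p]. *)
Record markov_process (d : measure_display) (W : measurableType d)
    (P : probability W R) (p : R -> S -> S -> R) (X : R -> W -> S) : Prop :=
  MarkovProcess {
  process_measurable : forall t x, 0 <= t -> measurable [set w | X t w = x];
  process_right_continuous : forall w t, 0 <= t ->
    \forall s \near t^'+, X s w = X t w;
  process_markov : forall (n : nat) (t : nat -> R) (x : nat -> S),
    t 0%N = 0 -> (forall k, t k <= t k.+1) ->
    (P (\bigcap_(k in `I_n.+1) [set w | X (t k) w = x k]) =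
     P [set w | X 0%R w = x 0%N] *
       (\prod_(k < n) p (t k.+1 - t k) (x k) (x k.+1))%:E)%E }.

Definition starts_at (d : measure_display) (W : measurableType d)
    (P : probability W R) (X : R -> W -> S) (x : S) : Prop :=
  P [set w | X 0 w = x] = 1%E.

Definition irreducible p : Prop :=
  forall x y, exists2 t, 0 <= t & 0 < p t x y.

(* The first time at which [X] is in [x] after having left it. *)
Definition return_time (W : Type) (X : R -> W -> S) (x : S) (w : W) : \bar R :=
  ereal_inf [set t%:E | t in [set t : R |
    X t w = x /\ exists2 s, 0 <= s < t & X s w != x]].

(* [x] is absorbing or has a finite mean return time. *)
Definition positive_recurrent_state p (x : S) : Prop :=
  (forall t, 0 <= t -> p t x x = 1) \/
  exists (d : measure_display) (W : measurableType d) (P : probability W R)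
    (X : R -> W -> S),
    [/\ markov_process P p X, starts_at P X x &
        (\int[P]_w return_time X x w < +oo)%E].

Definition positive_recurrent p : Prop :=
  forall x, positive_recurrent_state p x.

End continuous_time_markov_processes.

Section rates.
Variables (R : realType) (F : countType).
Implicit Type Q : F -> F -> R.

(* The total rate at which [Q] leaves [i]. *)
Definition exit_rate Q (i : F) : \bar R :=
  (\esum_(j in [set j | j != i]) (Q i j)%:E)%E.

(* The diagonal of [Q] is left unconstrained (so that both conventions
   [Q i i = 0] and [Q i i = - exit_rate Q i] are covered); it contributes
   nothing to the generators below nor to [lambda]. *)
Definition rate_matrix Q : Prop :=
  (forall i j, i != j -> 0 <= Q i j) /\ (forall i, (exit_rate Q i < +oo)%E).

Definition rate_generator Q (f : F -> R) (i : F) : R :=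
  rsum (fun j => Q i j * (f j - f i)).

Definition irreducible_positive_recurrent_rates Q : Prop :=
  rate_matrix Q /\
  exists p, [/\ transition_function_of (rate_generator Q) p,
                irreducible p & positive_recurrent p].

(* [+oo] when [F] is a singleton. *)
Definition lambda Q : \bar R :=
  ereal_inf [set ((Q ii.1 ii.2 + Q ii.2 ii.1)%:E +
      \esum_(j in [set j | j != ii.1 /\ j != ii.2])
        (Num.min (Q ii.1 j) (Q ii.2 j))%:E)%E
    | ii in [set ii : F * F | ii.1 != ii.2]].

Definition sup_rate (p0 : F -> R) : \bar R := ereal_sup (range (EFin \o p0)).
Definition inf_rate (p0 : F -> R) : \bar R := ereal_inf (range (EFin \o p0)).

End rates.

Section conditioned_semigroup.
Variables (R : realType) (F : countType).

(* The state space with cemetery [0] is [option F], where [None] is [0]. *)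
Definition killed_generator (Q : F -> F -> R) (p0 : F -> R)
    (f : option F -> R) (x : option F) : R :=
  if x is Some i then
    p0 i * (f None - f (Some i)) +
    rsum (fun j => Q i j * (f (Some j) - f (Some i)))
  else 0.

Definition extend0 (f : F -> R) (x : option F) : R :=
  if x is Some i then f i else 0.

(* [mu T_t f], where [p] is the transition function of the killed process
   and the probability measure [mu] on [F] is given by its masses. *)
Definition conditioned (p : R -> option F -> option F -> R)
    (mu : F -> R) (t : R) (f : F -> R) : R :=
  rsum (fun y => semigroup p t (extend0 f) (Some y) * mu y) /
  rsum (fun y => semigroup p t \1_(~` [set None]) (Some y) * mu y).

End conditioned_semigroup.

Section fleming_viot.
Variables (R : realType) (F : countType).

(* A function [F -> nat] of finite total mass is finitely supported. *)
Definition config (N : nat) :=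
  {eta : {fsfun F -> nat with 0%N} | (\sum_(i <- finsupp eta) eta i == N)%N}.

Definition occ (N : nat) (eta : config N) (i : F) : nat := val eta i.

Definition move_fsfun (i j : F) (eta : {fsfun F -> nat with 0%N}) :
    {fsfun F -> nat with 0%N} :=
  let eta' := [fsfun eta with i |-> (eta i).-1] in
  [fsfun eta' with j |-> (eta' j).+1].

(* When [occ eta i = 0] this is [eta]; otherwise see [val_move]. *)
Definition move (N : nat) (i j : F) (eta : config N) : config N :=
  insubd eta (move_fsfun i j (val eta)).

Lemma sum_fsfun_with (f : {fsfun F -> nat with 0%N}) (i : F) (v : nat) :
  (\sum_(k <- finsupp [fsfun f with i |-> v]) [fsfun f with i |-> v] k + f i =
   \sum_(k <- finsupp f) f k + v)%N.
Proof.
set A := (i |` finsupp f)%fset; set g := [fsfun f with i |-> v].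
have gE k : g k = if k == i then v else f k by rewrite /g fsfun_withE.
have sub_g : (finsupp g `<=` A)%fset.
  apply/fsubsetP => k; rewrite in_fset1U !mem_finsupp gE.
  by case: (k =P i).
have sub_f : (finsupp f `<=` A)%fset by exact: fsubsetUr.
rewrite (big_fset_incl _ sub_g); last by move=> k _; rewrite memNfinsupp => /eqP.
rewrite (big_fset_incl _ sub_f); last by move=> k _; rewrite memNfinsupp => /eqP.
have iA : i \in A by rewrite in_fset1U eqxx.
rewrite !(big_fsetD1 i iA) /= gE eqxx.
rewrite (eq_big_seq (fun k => f k)) /=; last first.
  by move=> k; rewrite in_fsetD1 gE => /andP[/negPf->].
by rewrite addnC addnA -addnA [RHS]addnC addnCA addnA.
Qed.

Lemma val_move (N : nat) (i j : F) (eta : config N) : occ eta i != 0%N ->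
  val (move i j eta) = move_fsfun i j (val eta).
Proof.
rewrite /occ => ei; rewrite val_insubd ifT// /move_fsfun.
set eta' := [fsfun val eta with i |-> _].
have := sum_fsfun_with eta' j (eta' j).+1.
have := sum_fsfun_with (val eta) i (val eta i).-1.
rewrite -/eta' (eqP (valP eta)) => e1 e2; apply/eqP.
move/eqP: e2; rewrite addnS -addSn eqn_add2r => /eqP ->.
apply/eqP; rewrite -(eqn_add2r (val eta i).-1) addSn -addnS prednK ?lt0n//.
exact/eqP.
Qed.

Definition fv_generator (Q : F -> F -> R) (p0 : F -> R) (N : nat)
    (f : config N -> R) (eta : config N) : R :=
  rsum (fun i => (occ eta i)%:R *
    rsum (fun j => (f (move i j eta) - f eta) *
                   (Q i j + p0 i * ((occ eta j)%:R / (N.-1)%:R)))).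

Definition fleming_viot (Q : F -> F -> R) (p0 : F -> R) (N : nat)
    (d : measure_display) (W : measurableType d) (P : probability W R)
    (X : R -> W -> config N) : Prop :=
  exists2 p, transition_function_of (@fv_generator Q p0 N) p &
             markov_process P p X.

(* The masses of the empirical distribution [m(eta)]. *)
Definition empirical (N : nat) (eta : config N) (k : F) : R :=
  N%:R^-1 * (occ eta k)%:R.

Definition mean (mu : F -> R) (f : F -> R) : R := rsum (fun j => f j * mu j).

End fleming_viot.

(* Main.v *)
(* Let [P_t] be the semigroup of the killed process, [h_t = P_t 1] and
   [u_t = P_t phi], so that [mu T_t phi = mu(u_t) / mu(h_t)].  Put
   [D = sup p0 - inf p0 < l <= lambda] and [c = 1 - D / l].  Comparing the rates at
   two points shows that [c <= h_t(i) / h_t(i')] for all times, and then that the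
   oscillation of [u_t / h_t] decays like [exp (- c l t)].

   For fixed [t] and [k = m(eta) T_t phi], the function
   [V_s(x) = (m(x) T_s phi - k)^2] satisfies [V_t(eta) = 0], and
   [E_eta (V_0(eta_t))] is the quantity to be bounded.  The generator of the
   particle system applied to [V_s] differs from [d/ds V_s] by at most a
   constant times [osc (u_s / h_s) / N], because a jump moves the empirical measure by
   [O(1 / N)].  As this oscillation is integrable in [s], [E_eta (V_0(eta_t))] is
   [O(1 / N)] uniformly in [t], whence the result with [gamma = 1 / 2].

   The argument is carried out on the Euler scheme [1 + e G] of the killed process,
   for which both comparisons hold exactly, and [e] tends to [0] at the end. *)
Require Import Defs.
From HB Require Import structures.
From mathcomp Require Import all_boot all_order all_algebra.
From mathcomp Require Import finmap.
From mathcomp Require Import all_classical all_reals all_analysis.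
From mathcomp Require Import measurable_realfun.
From mathcomp Require Import ring lra.
Import Order.TTheory GRing.Theory Num.Theory.
Import numFieldNormedType.Exports.

Set Implicit Arguments.
Unset Strict Implicit.
Unset Printing Implicit Defensive.

Local Open Scope classical_set_scope.
Local Open Scope ring_scope.

(** * Absolutely summable families *)

Section rsum_theory.
Variables (R : realType) (S : choiceType).
Implicit Types (f g a b : S -> R).

(** What makes the constants independent of [N] is that [h] stays between [c M] and [M], with [M]
    its supremum. The mean of [h] over any configuration, also after a jump, is then at least [c M],
    so the quotient defining the conditioned law stays under control. The value of [M] may decay in
    time, but it cancels from every final estimate. In continuous time the comparisons would be
    differential inequalities for suprema over an infinite set, which need not be attained. For
    [1 + e G] with [e] small, positivity and the comparison of two rows suffice. A generator is
    given only as a pointwise right derivative at time [0]. Bounded exit rates turn this into a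
    one-step error [O(e^2)] uniform in the state. For the particle system its constant grows with
    [N]; this is harmless, because [N] and [t] are fixed while [e] tends to [0], and [t / e] such
    errors then vanish. *)

Definition absolutely_summable f : Prop :=
  (\esum_(x in [set: S]) (`|f x|)%:E < +oo)%E.

Notation summ := absolutely_summable.

Lemma esum_fin_num f : summ f -> (forall x, 0 <= f x) ->
  (\esum_(x in [set: S]) (f x)%:E)%E \is a fin_num.
Proof.
move=> sf f0; rewrite ge0_fin_numE; last by apply: esum_ge0 => x _; rewrite lee_fin.
by apply: le_lt_trans sf; apply: le_esum => x _; rewrite lee_fin ler_norm.
Qed.

Lemma summ_le f g : (forall x, `|f x| <= g x) -> summ g -> summ f.
Proof.
move=> fg; apply: le_lt_trans; apply: le_esum => x _.
by rewrite lee_fin (le_trans (fg x))// ler_norm.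
Qed.

Lemma summ_abs f : summ f -> summ (fun x => `|f x|).
Proof. by apply: le_lt_trans; apply: le_esum => x _; rewrite normr_id. Qed.

Lemma summD f g : summ f -> summ g -> summ (fun x => f x + g x).
Proof.
move=> sf sg; apply: le_lt_trans (lte_add_pinfty sf sg).
rewrite -esumD => [|x _|x _]; rewrite ?lee_fin//.
by apply: le_esum => x _; rewrite -EFinD lee_fin ler_normD.
Qed.

Lemma esumZ (k : R) f : 0 <= k -> (forall x, 0 <= f x) ->
  (\esum_(x in [set: S]) (k * f x)%:E =
   k%:E * \esum_(x in [set: S]) (f x)%:E)%E.
Proof.
have H (l : R) g : 0 < l -> (forall x, 0 <= g x) ->
    (\esum_(x in [set: S]) (l * g x)%:E <=
     l%:E * \esum_(x in [set: S]) (g x)%:E)%E.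
  move=> l0 g0; apply: ge_ereal_sup => _ [X [finX XI]] <-.
  under eq_fsbigr do rewrite EFinM.
  rewrite -ge0_mule_fsumr; last by move=> x; rewrite lee_fin.
  by apply: lee_wpmul2l; rewrite ?lee_fin ?(ltW l0)//; apply: esum_ge; exists X.
rewrite le_eqVlt => /predU1P[<-|k0] f0.
  by rewrite mul0e esum1// => x _; rewrite mul0r.
apply/eqP; rewrite eq_le H//=.
have -> : (\esum_(x in [set: S]) (f x)%:E =
           \esum_(x in [set: S]) (k^-1 * (k * f x))%:E)%E.
  by apply: eq_esum => x _; rewrite mulrA mulVf ?gt_eqF// mul1r.
rewrite muleC -lee_pdivlMr// muleC.
by apply: H; rewrite ?invr_gt0// => x; rewrite mulr_ge0// ltW.
Qed.

Lemma summZ (k : R) f : summ f -> summ (fun x => k * f x).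
Proof.
move=> sf; rewrite /summ; under eq_esum do rewrite normrM.
by rewrite esumZ// lte_mul_pinfty// ?lee_fin.
Qed.

Lemma summN f : summ f -> summ (fun x => - f x).
Proof. by move=> sf; rewrite /summ; under eq_esum do rewrite normrN. Qed.

Lemma summB f g : summ f -> summ g -> summ (fun x => f x - g x).
Proof. by move=> sf /summN; exact: summD. Qed.

Lemma summ_mul_bounded a f (M : R) :
  summ a -> (forall x, `|f x| <= M) -> summ (fun x => a x * f x).
Proof.
move=> sa fM; apply: (@summ_le _ (fun x => M * `|a x|)).
  by move=> x; rewrite normrM mulrC ler_wpM2r.
exact/summZ/summ_abs.
Qed.

(** Freedom in the choice of the decomposition [a - b] spares any computation of the positive part
    of a sum, so that linearity reduces to that of nonnegative sums. *)
Lemma rsum_posneg f a b : (forall x, 0 <= a x) -> (forall x, 0 <= b x) ->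
  summ a -> summ b -> (forall x, f x = a x - b x) ->
  rsum f = fine (\esum_(x in [set: S]) (a x)%:E)%E
         - fine (\esum_(x in [set: S]) (b x)%:E)%E.
Proof.
move=> a0 b0 sa sb fE; rewrite /rsum.
have -> : EFin \o f = ((EFin \o a) \- (EFin \o b))%E.
  by apply/funext => x /=; rewrite fE EFinB.
rewrite esumB//= => [|x _|x _]; rewrite ?lee_fin//.
by rewrite fineB//; exact: esum_fin_num.
Qed.

Lemma ge0_rsumE f : (forall x, 0 <= f x) -> summ f ->
  rsum f = fine (\esum_(x in [set: S]) (f x)%:E)%E.
Proof.
move=> f0 sf; have s0 : summ (fun=> 0) by rewrite /summ esum1// => x; rewrite normr0.
rewrite (@rsum_posneg f f (fun=> 0))// => [|x]; last by rewrite subr0.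
by rewrite [X in _ - fine X]esum1//= subr0.
Qed.

Lemma ge0_rsum_EFin f : (forall x, 0 <= f x) -> summ f ->
  ((rsum f)%:E = \esum_(x in [set: S]) (f x)%:E)%E.
Proof. by move=> f0 sf; rewrite ge0_rsumE// fineK// esum_fin_num. Qed.

Lemma ge0_rsum f : (forall x, 0 <= f x) -> 0 <= rsum f.
Proof.
move=> f0; rewrite /rsum [X in fine (_ - X)]esum1 ?sube0.
  by rewrite fine_ge0// esum_ge0.
by move=> x _; rewrite funenegE; apply/max_idPr; rewrite leeNl oppe0 lee_fin.
Qed.

Lemma eq_rsum f g : (forall x, f x = g x) -> rsum f = rsum g.
Proof. by move=> /funext ->. Qed.

Let pos f x := Num.max (f x) 0.
Let neg f x := Num.max (- f x) 0.

Let posnegE f x : f x = pos f x - neg f x.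
Proof. by rewrite /pos /neg; case: (leP (f x) 0); case: (leP (- f x) 0); lra. Qed.

Let pos_ge0 f x : 0 <= pos f x. Proof. by rewrite le_max lexx orbT. Qed.
Let neg_ge0 f x : 0 <= neg f x. Proof. by rewrite le_max lexx orbT. Qed.

Let summ_pos f : summ f -> summ (pos f).
Proof.
move=> /summ_abs; apply: summ_le => x.
by rewrite ger0_norm// ge_max ler_norm normr_ge0.
Qed.

Let summ_neg f : summ f -> summ (neg f).
Proof.
move=> /summ_abs; apply: summ_le => x.
by rewrite ger0_norm// ge_max -normrN ler_norm normr_ge0.
Qed.

Let rsumE f : summ f -> rsum f = rsum (pos f) - rsum (neg f).
Proof.
move=> sf; rewrite (ge0_rsumE (pos_ge0 f) (summ_pos sf)).
rewrite (ge0_rsumE (neg_ge0 f) (summ_neg sf)).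
by rewrite (@rsum_posneg f (pos f) (neg f))//; [exact: summ_pos|exact: summ_neg].
Qed.

Lemma rsumD f g : summ f -> summ g ->
  rsum (fun x => f x + g x) = rsum f + rsum g.
Proof.
move=> sf sg; have [sfp sfn] := (summ_pos sf, summ_neg sf).
have [sgp sgn] := (summ_pos sg, summ_neg sg).
rewrite (@rsum_posneg _ (fun x => pos f x + pos g x) (fun x => neg f x + neg g x));
  [|by move=> x; rewrite addr_ge0..|exact: summD|exact: summD|]; last first.
  by move=> x; rewrite {1}(posnegE f) {1}(posnegE g); ring.
have esumDE u v : (forall x, 0 <= u x) -> (forall x, 0 <= v x) ->
    summ u -> summ v ->
    fine (\esum_(x in [set: S]) (u x + v x)%:E)%E = rsum u + rsum v.
  move=> u0 v0 su sv; rewrite !ge0_rsumE//.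
  under eq_esum do rewrite EFinD.
  by rewrite esumD ?fineD ?esum_fin_num// => x _; rewrite lee_fin.
by rewrite !esumDE// (rsumE sf) (rsumE sg); ring.
Qed.

Lemma rsum0 : rsum (fun _ : S => 0 : R) = 0.
Proof.
have s0 : summ (fun=> 0) by rewrite /summ esum1// => x; rewrite normr0.
by rewrite ge0_rsumE// esum1.
Qed.

Lemma rsum_eq1_neq0 f : rsum f = 1 -> exists x, f x != 0.
Proof.
move=> f1; apply: contrapT => /forallNP H; move: f1.
rewrite (@eq_rsum _ (fun=> 0)) ?rsum0; first by move/esym/eqP; rewrite oner_eq0.
by move=> x; have := H x; move/negP; rewrite negbK => /eqP.
Qed.

Lemma rsumN f : summ f -> rsum (fun x => - f x) = - rsum f.
Proof.
move=> sf; apply/eqP; rewrite -subr_eq0 opprK -rsumD//; last exact: summN.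
by rewrite (@eq_rsum _ (fun=> 0)) ?rsum0// => x; rewrite addNr.
Qed.

Lemma rsumB f g : summ f -> summ g ->
  rsum (fun x => f x - g x) = rsum f - rsum g.
Proof. by move=> sf sg; rewrite rsumD ?rsumN//; exact: summN. Qed.

Lemma rsumZ (k : R) f : summ f -> rsum (fun x => k * f x) = k * rsum f.
Proof.
have H l g : 0 <= l -> summ g -> rsum (fun x => l * g x) = l * rsum g.
  move=> l0 sg; rewrite (rsumE sg).
  rewrite (@rsum_posneg _ (fun x => l * pos g x) (fun x => l * neg g x));
    [|by move=> x; rewrite mulr_ge0..|exact/summZ/summ_pos
     |exact/summZ/summ_neg|by move=> x; rewrite -mulrBr -posnegE].
  rewrite !esumZ// !fineM//= ?esum_fin_num//; [|exact: summ_neg|exact: summ_pos].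
  by rewrite -!ge0_rsumE ?mulrBr//; [exact: summ_neg|exact: summ_pos].
move=> sf; case: (leP 0 k) => [k0|k0]; first exact: H.
rewrite -[RHS]opprK -mulNr -H//; last by rewrite oppr_ge0 ltW.
rewrite -rsumN; last exact: summZ.
by apply: eq_rsum => x; rewrite mulNr opprK.
Qed.

Lemma ler_rsum f g : summ f -> summ g -> (forall x, f x <= g x) ->
  rsum f <= rsum g.
Proof.
move=> sf sg fg; rewrite -subr_ge0 -rsumB//; apply: ge0_rsum => x.
by rewrite subr_ge0.
Qed.

Lemma ler_norm_rsum f : summ f -> `|rsum f| <= rsum (fun x => `|f x|).
Proof.
move=> sf; have sa := summ_abs sf.
rewrite ler_norml -rsumN//; apply/andP; split; apply: ler_rsum => //.
- exact: summN.
- by move=> x; rewrite lerNl -normrN ler_norm.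
- by move=> x; rewrite ler_norm.
Qed.

Lemma summ_delta (i : S) f : summ (fun j => (j == i)%:R * f j).
Proof.
rewrite /summ (_ : (\esum_(_ in _) _)%E = \esum_(j in [set i]) `|f j|%:E)%E.
  by rewrite esum_set1 ?lee_fin// ltry.
rewrite [RHS]esum_mkcond; apply: eq_esum => j _.
by rewrite in_set1; case: eqP; rewrite ?mul1r ?mul0r ?normr0.
Qed.

Lemma rsum_delta (i : S) f : rsum (fun j => (j == i)%:R * f j) = f i.
Proof.
rewrite (@eq_rsum _ (fun j => f i * ((j == i)%:R * 1))); last first.
  by move=> j; case: eqP => [->|]; rewrite ?mul1r ?mul0r ?mulr1 ?mulr0.
rewrite rsumZ; last exact: summ_delta.
rewrite ge0_rsumE; [|by move=> j; rewrite mulr1|exact: summ_delta].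
rewrite (_ : (\esum_(_ in _) _)%E = \esum_(j in [set i]) 1%:E)%E.
  by rewrite esum_set1 ?lee_fin//= mulr1.
rewrite [RHS]esum_mkcond; apply: eq_esum => j _.
by rewrite in_set1 mulr1; case: eqP.
Qed.

Definition bounded f : Prop := exists M : R, forall x, `|f x| <= M.

Lemma bounded_cst (k : R) : bounded (fun=> k).
Proof. by exists `|k|. Qed.

Lemma boundedD f g : bounded f -> bounded g -> bounded (fun x => f x + g x).
Proof.
by move=> [M fM] [K gK]; exists (M + K) => x; rewrite (le_trans (ler_normD _ _))// lerD.
Qed.

Lemma boundedN f : bounded f -> bounded (fun x => - f x).
Proof. by move=> [M fM]; exists M => x; rewrite normrN. Qed.

Lemma boundedB f g : bounded f -> bounded g -> bounded (fun x => f x - g x).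
Proof. by move=> bf /boundedN; exact: boundedD. Qed.

Lemma boundedM f g : bounded f -> bounded g -> bounded (fun x => f x * g x).
Proof. by move=> [M fM] [K gK]; exists (M * K) => x; rewrite normrM ler_pM. Qed.

Lemma boundedZ k f : bounded f -> bounded (fun x => k * f x).
Proof. exact/boundedM/bounded_cst. Qed.

Lemma bounded_bool (P : pred S) : bounded (fun x => (P x)%:R).
Proof. by exists 1 => x; case: (P x); rewrite ?normr1 ?normr0. Qed.

(** A finite measure given by its masses. Rows of transition functions, rows of rate matrices and
    empirical distributions are all integrated in this form. *)
Definition summable_weight a := (forall x, 0 <= a x) /\ summ a.

Section weight.
Variables (a : S -> R) (wa : summable_weight a).

Let a0 x : 0 <= a x. Proof. exact: wa.1. Qed.
Let sa : summ a. Proof. exact: wa.2. Qed.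

Lemma wsumm f : bounded f -> summ (fun x => a x * f x).
Proof. by move=> [M]; exact: summ_mul_bounded. Qed.

Lemma wsumD f g : bounded f -> bounded g ->
  rsum (fun x => a x * (f x + g x)) =
  rsum (fun x => a x * f x) + rsum (fun x => a x * g x).
Proof.
move=> bf bg; rewrite -rsumD; [|exact: wsumm..].
by apply: eq_rsum => x; rewrite mulrDr.
Qed.

Lemma wsumB f g : bounded f -> bounded g ->
  rsum (fun x => a x * (f x - g x)) =
  rsum (fun x => a x * f x) - rsum (fun x => a x * g x).
Proof.
move=> bf bg; rewrite -rsumB; [|exact: wsumm..].
by apply: eq_rsum => x; rewrite mulrBr.
Qed.

Lemma wsumZ k f : bounded f ->
  rsum (fun x => a x * (k * f x)) = k * rsum (fun x => a x * f x).
Proof.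
move=> bf; rewrite -rsumZ; last exact: wsumm.
by apply: eq_rsum => x; rewrite mulrCA.
Qed.

Lemma wsum_cst k : rsum (fun x => a x * k) = k * rsum a.
Proof. by rewrite -rsumZ//; apply: eq_rsum => x; rewrite mulrC. Qed.

Lemma ler_wsum f g : bounded f -> bounded g ->
  (forall x, a x != 0 -> f x <= g x) ->
  rsum (fun x => a x * f x) <= rsum (fun x => a x * g x).
Proof.
move=> bf bg fg; apply: ler_rsum; [exact: wsumm..|] => x.
by have [->|ax] := eqVneq (a x) 0; rewrite ?mul0r// ler_wpM2l// fg.
Qed.

(** The bound is asked on the support only: in the particle system, jumps are controlled from
    occupied sites alone. *)
Lemma wsum_norm f (M : R) : (forall x, a x != 0 -> `|f x| <= M) ->
  `|rsum (fun x => a x * f x)| <= M * rsum a.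
Proof.
move=> fM; have afM x : `|a x * f x| <= M * a x.
  have [->|ax] := eqVneq (a x) 0; first by rewrite mul0r mulr0 normr0.
  by rewrite normrM ger0_norm// mulrC ler_wpM2r// fM.
have saf : summ (fun x => a x * f x) by apply: summ_le afM _; exact: summZ.
apply: (le_trans (ler_norm_rsum saf)); rewrite -rsumZ//.
by apply: ler_rsum => //; [exact: summ_abs|exact: summZ].
Qed.

End weight.

End rsum_theory.

#[global] Hint Resolve bounded_cst bounded_bool : core.

(** * Semigroups with bounded generators *)

Section dominated_convergence.
Variables (R : realType) (S : choiceType).

Lemma esum_exchange (S' : choiceType) (a : S -> S' -> \bar R) :
  (forall i j, 0 <= a i j)%E ->
  (\esum_(i in [set: S]) \esum_(j in [set: S']) a i j =
   \esum_(j in [set: S']) \esum_(i in [set: S]) a i j)%E.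
Proof.
move=> a0; rewrite !esum_esum//.
rewrite (@reindex_esum _ _ _ ([set: S'] `*`` fun=> [set: S]) _
  (fun x => (x.2, x.1)))//; split=> //=.
- by move=> [? ?] [? ?] _ _ [-> ->].
- by move=> [i j] _; exists (j, i).
Qed.

(** The total mass is a supremum over finite sets, so one of them carries all of it but [e]. *)
Lemma summable_weight_truncate (a : S -> R) (e : R) : summable_weight a -> 0 < e ->
  exists2 X : {fset S}, True & rsum (fun x => a x * (x \notin X)%:R) <= e.
Proof.
move=> wa e0; have [a0 sa] := wa.
have : ((rsum a - e)%:E < \esum_(x in [set: S]) (a x)%:E)%E.
  by rewrite -ge0_rsum_EFin// lte_fin ltrBlDr ltrDl.
move=> /ereal_sup_gt[_ [X [finX _] <-]] aX.
exists (fset_set X) => //.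
have b1 := @bounded_bool R S.
rewrite (@eq_rsum _ _ _ (fun x => a x * (1 - (x \in fset_set X)%:R))); last first.
  by move=> x; case: (x \in _); rewrite ?subrr ?subr0.
rewrite wsumB; [|exact: wa|exact: (b1 predT)|exact: b1].
rewrite (@eq_rsum _ _ (fun x => a x * 1) a); last by move=> x; rewrite mulr1.
rewrite lerBlDr -lerBlDl -lee_fin ge0_rsum_EFin; last 2 first.
- by move=> x; rewrite mulr_ge0.
- by apply: wsumm => //; exact: b1.
apply: (le_trans (ltW aX)); apply: esum_ge; exists X => //.
rewrite le_eqVlt; apply/orP; left; apply/eqP; apply: eq_fsbigr => x xX.
by rewrite in_fset_set// xX mulr1.
Qed.

(** Dominated convergence along an arbitrary filter, here mostly right neighbourhoods of [0]. On a
    finite set carrying almost all the mass, pointwise convergence is uniform; the rest is bounded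
    by [B]. *)
Lemma wsum_cvg (a : S -> R) (I : Type) (F : set_system I) (g : I -> S -> R)
    (g0 : S -> R) (B : R) : Filter F -> summable_weight a ->
  (\forall i \near F, forall x, `|g i x| <= B) -> (forall x, `|g0 x| <= B) ->
  (forall x, g i x @[i --> F] --> g0 x) ->
  rsum (fun x => a x * g i x) @[i --> F] --> rsum (fun x => a x * g0 x).
Proof.
move=> FF wa gB g0B gcvg; apply/cvgrPdist_le => e e0.
have B0 : 0 <= `|B| + 1 by rewrite addr_ge0.
have ra0 : 0 <= rsum a by apply: ge0_rsum; exact: wa.1.
(* Half of [e] goes to the finite set, of mass at most [rsum a], and half to the tail, where the
   difference is at most twice the bound [B]. *)
pose e1 := e / (2 * (rsum a + 1)); pose e2 := e / (4 * (`|B| + 1)).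
have e1p : 0 < e1 by rewrite divr_gt0// mulr_gt0// ltr_wpDl.
have e2p : 0 < e2 by rewrite divr_gt0// mulr_gt0// ltr_wpDl.
have [X _ Xe] := summable_weight_truncate wa e2p.
have nX : \forall i \near F, forall x, x \in X -> `|g0 x - g i x| <= e1.
  have : F (\bigcap_(x in [set` X]) [set i | `|g0 x - g i x| <= e1]).
    by apply: filter_bigI => x _; move/cvgrPdist_le: (gcvg x); exact.
  by apply: filterS => i iX x xX; exact: (iX x xX).
near=> i.
have giB : forall x, `|g i x| <= B by near: i.
have giX : forall x, x \in X -> `|g0 x - g i x| <= e1 by near: i.
rewrite -wsumB//; [|by exists B..].
rewrite (@eq_rsum _ _ _ (fun x => a x * (x \in X)%:R * (g0 x - g i x) +
   a x * (x \notin X)%:R * (g0 x - g i x))); last first.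
  by move=> x; case: (x \in X) => /=; ring.
have b1 := @bounded_bool R S.
have wX (P : pred S) : summable_weight (fun x => a x * (P x)%:R).
  split => [x|]; first by rewrite mulr_ge0//; exact: wa.1.
  by apply: wsumm => //; exact: b1.
have dB : forall x, `|g0 x - g i x| <= B + B.
  by move=> x; rewrite (le_trans (ler_normB _ _))// lerD.
rewrite rsumD; last 2 first.
- by apply: (wsumm (wX (fun x => x \in X))); exists (B + B).
- by apply: (wsumm (wX (fun x => x \notin X))); exists (B + B).
rewrite (le_trans (ler_normD _ _))// (splitr e) lerD//.
  apply: le_trans (wsum_norm (wX (fun x => x \in X)) (M := e1) _) _.
    move=> x; case: (boolP (x \in X)) => [xX _|_]; last by rewrite mulr0 eqxx.
    exact: giX.
  apply: (@le_trans _ _ (e1 * (rsum a + 1))).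
    rewrite ler_wpM2l ?(ltW e1p)//; apply: (@le_trans _ _ (rsum a));
      last by rewrite lerDl.
    apply: ler_rsum; [exact: (wX (fun x => x \in X)).2|exact: wa.2|] => x.
    by rewrite ler_piMr ?wa.1//; case: (x \in X).
  rewrite /e1 le_eqVlt; apply/orP; left; apply/eqP; field.
  by rewrite gt_eqF// ltr_wpDl.
apply: le_trans (wsum_norm (wX (fun x => x \notin X)) (M := 2 * (`|B| + 1)) _) _.
  move=> x _; apply: (le_trans (dB x)).
  by rewrite mulr2n mulrDl !mul1r lerD// (le_trans (ler_norm _))// lerDl.
apply: (@le_trans _ _ (2 * (`|B| + 1) * e2)).
  by rewrite ler_wpM2l// mulr_ge0.
rewrite /e2 le_eqVlt; apply/orP; left; apply/eqP; field.
by rewrite gt_eqF// ltr_wpDl.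
Unshelve. all: by end_near. Qed.

End dominated_convergence.

(** A mean value inequality for right derivatives, the only ones a generator provides. Consider the
    times up to [s] at which the bound with slope [b + e] holds: the Lipschitz estimate puts their
    supremum in the set, and the right derivative there would lead further unless it equals [s]. *)
Lemma right_derivative_le (R : realType) (phi d : R -> R) (L b s : R) :
  0 <= s -> (forall t u, 0 <= t -> 0 <= u -> `|phi (t + u) - phi t| <= L * u) ->
  (forall t, 0 <= t < s -> (fun u => (phi (t + u) - phi t) / u) @ 0^'+ --> d t) ->
  (forall t, 0 <= t < s -> d t <= b) ->
  phi s <= phi 0 + b * s.
Proof.
move=> s0 Lphi dphi db; apply/ler_addgt0Pr => e' e'0.
pose e := e' / (s + 1); have s1 : 0 < s + 1 by rewrite ltr_wpDl.
have e0 : 0 < e by rewrite divr_gt0.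
suff : phi s <= phi 0 + (b + e) * s.
  move=> /le_trans; apply; rewrite mulrDl addrA lerD2l /e.
  by rewrite mulrAC ler_pdivrMr// ler_wpM2l ?(ltW e'0)// lerDl.
pose A := [set t | 0 <= t <= s /\ phi t <= phi 0 + (b + e) * t].
have A0 : A 0 by rewrite /A /= lexx s0 mulr0 addr0.
have supA : has_sup A by split; [exists 0|exists s => t [/andP[]]].
pose T := sup A.
have T0 : 0 <= T by apply: ub_le_sup => //; exact: supA.2.
have Ts : T <= s by apply: ge_sup; [exists 0|move=> t [/andP[]]].
have AT : phi T <= phi 0 + (b + e) * T.
  apply/ler_addgt0Pr => h h0.
  (* Moving from a time [t] of the set to [T] changes the two sides of the bound by at most
     [k * (T - t)] in total. *)
  pose k := `|L| + `|b + e| + 1.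
  have k0 : 0 < k by rewrite ltr_wpDl// addr_ge0.
  have [t [/andP[t0 ts] At] tT] := sup_adherent (divr_gt0 h0 k0) supA.
  have tT' : t <= T by apply: ub_le_sup; [exact: supA.2|rewrite /A /= t0 ts].
  have := Lphi t (T - t) t0; rewrite subr_ge0 => /(_ tT').
  rewrite [t + _]addrC subrK => LT.
  have Tt : T - t <= h / k by move: tT; rewrite -/T; lra.
  have kh : k * (T - t) <= h by rewrite mulrC -ler_pdivlMr.
  have Tt0 : 0 <= T - t by rewrite subr_ge0.
  have l1 : L * (T - t) <= `|L| * (T - t) by rewrite ler_wpM2r// ler_norm.
  have l2 : (b + e) * (t - T) <= `|b + e| * (T - t).
    by rewrite -[t - T]opprB mulrN -mulNr ler_wpM2r// -normrN ler_norm.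
  have l3 := le_trans (ler_norm _) LT.
  move: kh; rewrite /k; nra.
suff -> : s = T by [].
apply/eqP; rewrite eq_le Ts andbT leNgt; apply/negP => {}Ts.
have Tr : 0 <= T < s by rewrite T0.
have := dphi T Tr => /cvgrPdist_lt /(_ e e0) nd.
have : \forall u \near 0^'+, u < s - T.
  by apply: nbhs_right_lt; rewrite subr_gt0.
have u0 : \forall u \near (0 : R)^'+, 0 < u by exact: nbhs_right_gt.
move=> ns; have [u [du [us {}u0]]] := filter_ex (filterI nd (filterI ns u0)).
have : A (T + u).
  split; first by rewrite addr_ge0 ?(ltW u0)//=; lra.
  have : (phi (T + u) - phi T) / u <= b + e.
    have := db T Tr; move: du; rewrite ltr_norml => /andP[]; lra.
  rewrite ler_pdivrMr//; lra.
move=> /(ub_le_sup supA.2); rewrite -/T; lra.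
Qed.

Section transition_semigroup.
Variables (R : realType) (S : choiceType) (p : R -> S -> S -> R).
Hypothesis tp : transition_function p.
Implicit Types (f g : S -> R) (M t s : R).

Local Notation P := (semigroup p).
Let b1 := @bounded_bool R S.

Lemma transition_weight t x : 0 <= t -> summable_weight (p t x).
Proof.
move=> t0; split => [y|]; first exact: transition_ge0.
rewrite /absolutely_summable; under eq_esum do rewrite ger0_norm ?transition_ge0//.
by rewrite transition_sum1// ltry.
Qed.
Local Notation wp := transition_weight.

Lemma rsum_transition t x : 0 <= t -> rsum (p t x) = 1.
Proof.
move=> t0; have [? ?] := wp x t0; apply: EFin_inj.
by rewrite ge0_rsum_EFin// transition_sum1.
Qed.

Lemma semigroup_cst t k x : 0 <= t -> P t (fun=> k) x = k.
Proof.
by move=> t0; rewrite /semigroup wsum_cst ?rsum_transition ?mulr1//; exact: wp.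
Qed.

Lemma semigroup_norm t f M x : 0 <= t -> (forall y, `|f y| <= M) -> `|P t f x| <= M.
Proof.
move=> t0 fM; apply: le_trans (wsum_norm (wp x t0) (M := M) _) _ => //.
by rewrite rsum_transition// mulr1.
Qed.

Lemma semigroup_bounded t f : 0 <= t -> bounded f -> bounded (P t f).
Proof. by move=> t0 [M fM]; exists M => x; exact: semigroup_norm. Qed.

Lemma semigroup_delta t x y : P t (fun z => (z == y)%:R) x = p t x y.
Proof.
rewrite /semigroup -[RHS](rsum_delta y); apply: eq_rsum => z.
by rewrite mulrC.
Qed.

Lemma ler_semigroup t f g x : 0 <= t -> bounded f -> bounded g ->
  (forall y, f y <= g y) -> P t f x <= P t g x.
Proof. by move=> t0 bf bg fg; apply: ler_wsum => //; exact: wp. Qed.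

Lemma transition_le1 t x y : 0 <= t -> p t x y <= 1.
Proof.
move=> t0; rewrite -semigroup_delta -[leRHS](semigroup_cst 1 x t0).
by apply: ler_semigroup => // z; case: eqP.
Qed.

Lemma ge0_semigroupD s t f x : 0 <= s -> 0 <= t -> bounded f ->
  (forall y, 0 <= f y) -> P (s + t) f x = P s (P t f) x.
Proof.
move=> s0 t0 bf f0; have st0 := addr_ge0 s0 t0.
have p0 u y z : 0 <= u -> 0 <= p u y z by exact: transition_ge0.
have wf u y : 0 <= u -> absolutely_summable (fun z => p u y z * f z).
  by move=> u0; apply: wsumm => //; exact: wp.
have Pf0 y : 0 <= P t f y by apply: ge0_rsum => z; rewrite mulr_ge0// p0.
apply: EFin_inj; rewrite /semigroup ge0_rsum_EFin//;
  [|by move=> z; rewrite mulr_ge0// p0|exact: wf].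
rewrite ge0_rsum_EFin; [|by move=> z; rewrite mulr_ge0// ?p0//; exact: Pf0|].
  2: by apply: wsumm; [exact: wp|exact: semigroup_bounded].
transitivity (\esum_(z in [set: S]) \esum_(y in [set: S])
    (p s x y * p t y z * f z)%:E)%E.
  apply: eq_esum => z _.
  rewrite transition_chapman_kolmogorov// mulrC EFinM ge0_rsum_EFin; last 2 first.
  - by move=> y; rewrite mulr_ge0// p0.
  - apply: wsumm; [exact: wp|exists 1 => y].
    by rewrite ger0_norm ?transition_le1// p0.
  rewrite -esumZ//; last by move=> y; rewrite mulr_ge0// p0.
  by apply: eq_esum => y _; rewrite mulrC.
rewrite esum_exchange; last by move=> z y; rewrite lee_fin !mulr_ge0// p0.
apply: eq_esum => y _; rewrite EFinM ge0_rsum_EFin; last 2 first.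
- by move=> z; rewrite mulr_ge0// p0.
- exact: wf.
rewrite -esumZ ?p0//; last by move=> z; rewrite mulr_ge0// p0.
by apply: eq_esum => z _; rewrite mulrA.
Qed.

Lemma semigroupB t f g x : 0 <= t -> bounded f -> bounded g ->
  P t (fun y => f y - g y) x = P t f x - P t g x.
Proof. by move=> t0; exact: (wsumB (wp x t0)). Qed.

Lemma semigroupZ t k f x : 0 <= t -> bounded f ->
  P t (fun y => k * f y) x = k * P t f x.
Proof. by move=> t0; exact: (wsumZ (wp x t0)). Qed.

(** Tonelli's theorem settles nonnegative functions. Adding the bound [M] makes [f] nonnegative, and
    constants are invariant because rows have mass [1]; the form [- - M] gives access to
    [semigroupB]. *)
Lemma semigroupD s t f x : 0 <= s -> 0 <= t -> bounded f ->
  P (s + t) f x = P s (P t f) x.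
Proof.
move=> s0 t0 bf; have [M fM] := bf; have st0 := addr_ge0 s0 t0.
have bfM : bounded (fun y => f y - - M) by exact: boundedB.
have := @ge0_semigroupD s t (fun y => f y - - M) x s0 t0 bfM.
have -> : P t (fun y => f y - - M) = (fun y => P t f y - - M).
  apply/funext => y; rewrite semigroupB// ?semigroup_cst//.
rewrite !semigroupB// ?semigroup_cst//; last exact: semigroup_bounded.
move=> H; apply: (@addIr _ (- - M)); apply: H => y.
by rewrite opprK -lerBlDr sub0r; have := fM y; rewrite ler_norml => /andP[].
Qed.

(** The difference [f y - f x] vanishes at [y = x] and is at most [2 M] elsewhere, so only the
    probability of being away from [x] counts. *)
Lemma semigroup_dist t f M x : 0 <= t -> (forall y, `|f y| <= M) ->
  `|P t f x - f x| <= 2 * M * (1 - p t x x).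
Proof.
move=> t0 fM; have bf : bounded f by exists M.
have bx : bounded (fun=> f x) by exists M.
rewrite -[X in _ - X](semigroup_cst (f x) x t0) -semigroupB//.
have -> : 1 - p t x x = P t (fun y => 1 - (y == x)%:R) x.
  by rewrite semigroupB ?semigroup_delta ?semigroup_cst//; exact: (b1 predT).
have bd : bounded (fun y => 1 - (y == x)%:R : R).
  exact: (@boundedB _ _ (fun=> 1) (fun y => (y == x)%:R)).
have bd' := boundedZ (2 * M) bd.
rewrite -semigroupZ// ler_norml -[X in X <= _ <= _]mulN1r -semigroupZ//.
have bff : bounded (fun y => f y - f x) by exact: boundedB.
have bd'' := boundedZ (-1) bd'.
have H y : `|f y - f x| <= 2 * M * (1 - (y == x)%:R).
  case: eqP => [->|_]; first by rewrite !subrr mulr0 normr0.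
  rewrite subr0 mulr1 (le_trans (ler_normB _ _))//.
  by rewrite mulr2n mulrDl mul1r lerD.
apply/andP; split; apply: ler_semigroup => // y.
  by have := H y; rewrite mulN1r ler_norml => /andP[].
by have := H y; rewrite ler_norml => /andP[].
Qed.

(** Being at [x] at every multiple of [t] is one way of being there at the end. *)
Lemma transition_diag_pow t x n : 0 <= t -> p t x x ^+ n <= p (n%:R * t) x x.
Proof.
move=> t0; elim: n => [|n ih].
  by rewrite expr0 mul0r transition_0// eqxx.
have nt0 : 0 <= n%:R * t by rewrite mulr_ge0.
rewrite -natr1 mulrDl mul1r transition_chapman_kolmogorov// exprSr.
apply: le_trans (ler_wpM2r (transition_ge0 tp _ _ t0) ih) _.
rewrite -[leLHS](rsum_delta x (fun y => p (n%:R * t) x y * p t y x)).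
apply: ler_rsum => [||y]; first exact: summ_delta.
  apply: wsumm; first exact: wp.
  by exists 1 => y; rewrite ger0_norm ?transition_le1// transition_ge0.
rewrite ler_piMl//; last by case: eqP.
by rewrite mulr_ge0//; exact: transition_ge0.
Qed.

Variable G : (S -> R) -> S -> R.
Hypothesis pG : has_generator p G.
Variable C : R.
Hypothesis C0 : 0 <= C.
Hypothesis GC : forall x, - C <= G (fun y => (y == x)%:R) x.

Lemma bernoulli_le (y : R) n : y <= 1 -> 1 - n%:R * y <= (1 - y) ^+ n.
Proof.
move=> y1; elim: n => [|n ih]; first by rewrite mul0r subr0 expr0.
rewrite exprS; have y0 : 0 <= 1 - y by rewrite subr_ge0.
apply: le_trans (ler_wpM2l y0 ih).
rewrite -natr1; have : 0 <= n%:R * y ^+ 2 by rewrite mulr_ge0// sqr_ge0.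
lra.
Qed.

(** The generator speaks only of small times, and not uniformly in [x]. Cutting [t] into many steps,
    [transition_diag_pow] and the Bernoulli inequality propagate the local bound to all times, with
    a constant that no longer depends on [x]. All uniform estimates below come from this one. *)
Lemma transition_diag_ge t x : 0 <= t -> 1 - C * t <= p t x x.
Proof.
rewrite le_eqVlt => /predU1P[<-|t0].
  by rewrite mulr0 subr0 transition_0// eqxx.
apply/ler_addgt0Pr => e' e'0; pose e := e' / t.
have e0 : 0 < e by rewrite divr_gt0.
have := @pG _ (b1 (fun y => y == x)) x.
move=> /cvgrPdist_lt/(_ e e0)[r /= r0 Hr].
have Ce : 0 < C + e by rewrite ltr_wpDl.
(* The two summands make the step [t / n] shorter than [r] and [(C + e) * (t / n)] at most [1], as
   the Bernoulli inequality requires. *)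
pose n := (Num.truncn (t / r) + Num.truncn ((C + e) * t)).+1.
have n0 : 0 < n%:R :> R by rewrite ltr0n.
have nr : t / n%:R < r.
  rewrite ltr_pdivrMr// mulrC -ltr_pdivrMr//.
  apply: (lt_le_trans (truncnS_gt _)).
  by rewrite ler_nat ltnS leq_addr.
have ny : (C + e) * (t / n%:R) <= 1.
  rewrite mulrA ler_pdivrMr// mul1r ltW//.
  apply: (lt_le_trans (truncnS_gt _)).
  by rewrite ler_nat ltnS leq_addl.
have h0 : 0 < t / n%:R by rewrite divr_gt0.
have : 1 - (C + e) * (t / n%:R) <= p (t / n%:R) x x.
  have := Hr (t / n%:R); rewrite /= sub0r normrN gtr0_norm// => /(_ nr h0).
  rewrite semigroup_delta eqxx ltr_norml => /andP[_].
  have := GC x => /= g1 g2.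
  have : - (C + e) < (p (t / n%:R) x x - 1) / (t / n%:R) by lra.
  by rewrite ltr_pdivlMr//; lra.
have y0 : 0 <= 1 - (C + e) * (t / n%:R) by rewrite subr_ge0.
move=> H; have := transition_diag_pow x n (ltW h0).
rewrite [n%:R * _]mulrC divfK ?gt_eqF//.
move/(le_trans (lerXn2r n y0 (le_trans y0 H) H)).
move/(le_trans (bernoulli_le n ny)).
rewrite mulrCA [n%:R * _]mulrC divfK ?gt_eqF// mulrDl /e divfK ?gt_eqF//; lra.
Qed.

Lemma semigroup_sub_id t f M x : 0 <= t -> (forall y, `|f y| <= M) ->
  `|P t f x - f x| <= 2 * M * C * t.
Proof.
move=> t0 fM; apply: (le_trans (semigroup_dist x t0 fM)).
have M0 : 0 <= M by apply: le_trans (fM x).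
rewrite -[leRHS]mulrA ler_wpM2l ?mulr_ge0//.
by have := transition_diag_ge x t0; lra.
Qed.

Lemma semigroup_lipschitz s t f M x : 0 <= s -> 0 <= t -> (forall y, `|f y| <= M) ->
  `|P (s + t) f x - P s f x| <= 2 * M * C * t.
Proof.
move=> s0 t0 fM; have bf : bounded f by exists M.
rewrite semigroupD// -semigroupB//; last exact: semigroup_bounded.
by apply: semigroup_norm => // y; exact: semigroup_sub_id.
Qed.

Lemma generator_norm f M x : (forall y, `|f y| <= M) -> `|G f x| <= 2 * M * C.
Proof.
move=> fM; have bf : bounded f by exists M.
have c : `|(P u f x - f x) / u| @[u --> 0^'+] --> `|G f x|.
  by apply: cvg_norm; exact: pG.
have <- := cvg_lim _ c; last by [].
apply: limr_le; first by apply/cvg_ex; eexists; exact: c.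
have : \forall t \near (0 : R)^'+, 0 < t by exact: nbhs_right_gt.
apply: filterS => t t0; rewrite normrM normfV (gtr0_norm t0) ler_pdivrMr//.
by apply: semigroup_sub_id => //; exact: ltW.
Qed.

(** Since [P (t + u) = P t (P u)], the quotient at time [t] is [P t] applied to the quotient at time
    [0], which converges pointwise and is bounded uniformly by [semigroup_sub_id]. *)
Lemma semigroup_derivative t f x : 0 <= t -> bounded f ->
  (fun u => (P (t + u) f x - P t f x) / u) @ 0^'+ --> P t (G f) x.
Proof.
move=> t0 bf; have [M fM] := bf.
have : P t (fun y => (P u f y - f y) / u) x @[u --> 0^'+] --> P t (G f) x.
  apply: (@wsum_cvg _ _ _ _ _ _ _ (2 * M * C)); first exact: wp.
  - have : \forall t \near (0 : R)^'+, 0 < t by exact: nbhs_right_gt.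
    apply: filterS => u u0 y; rewrite normrM normfV (gtr0_norm u0) ler_pdivrMr//.
    by apply: semigroup_sub_id => //; exact: ltW.
  - by move=> y; exact: generator_norm.
  - by move=> y; exact: pG.
apply: cvg_trans; apply: near_eq_cvg.
have : \forall t \near (0 : R)^'+, 0 < t by exact: nbhs_right_gt.
apply: filterS => u u0; rewrite semigroupD ?(ltW u0)//.
rewrite -semigroupB//; last by apply: semigroup_bounded => //; exact: ltW.
rewrite mulrC -semigroupZ//; last first.
  exists (2 * M * C * u) => y; apply: semigroup_sub_id => //; exact: ltW.
by apply: eq_rsum => y; rewrite [_ / u]mulrC.
Qed.

(** The function [P u f x - u * G f x] of [u] has right derivative [P u (G f) x - G f x]. As [G f]
    is bounded by [2 M C], this is at most [2 (2 M C) C t] in absolute value; the mean value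
    inequality is applied to both signs. *)
Lemma semigroup_euler t f M x : 0 <= t -> (forall y, `|f y| <= M) ->
  `|P t f x - (f x + t * G f x)| <= 4 * C ^+ 2 * M * t ^+ 2.
Proof.
move=> t0 fM; have bf : bounded f by exists M.
have M0 : 0 <= M by apply: le_trans (fM x).
have gM y : `|G f y| <= 2 * M * C by exact: generator_norm.
have bG u : 0 <= u < t -> `|P u (G f) x - G f x| <= 4 * C ^+ 2 * M * t.
  move=> /andP[u0 ut]; apply: (le_trans (semigroup_sub_id x u0 gM)).
  have -> : 4 * C ^+ 2 * M * t = 2 * (2 * M * C) * C * t by ring.
  by rewrite ler_wpM2l ?(ltW ut)// !mulr_ge0.
have H (sg : R) : `|sg| = 1 ->
    sg * (P t f x - (f x + t * G f x)) <= 4 * C ^+ 2 * M * t ^+ 2.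
  move=> sg1; pose phi u := sg * (P u f x - u * G f x).
  have P0 : P 0 f x = f x.
    rewrite /semigroup -[RHS](rsum_delta x); apply: eq_rsum => y.
    by rewrite transition_0// eq_sym.
  pose L := 2 * M * C + `|G f x|.
  have Lphi a b : 0 <= a -> 0 <= b -> `|phi (a + b) - phi a| <= L * b.
    move=> a0 b0; rewrite /phi -mulrBr normrM sg1 mul1r.
    have -> : P (a + b) f x - (a + b) * G f x - (P a f x - a * G f x) =
      (P (a + b) f x - P a f x) - b * G f x by ring.
    rewrite (le_trans (ler_normB _ _))// /L mulrDl lerD//.
      exact: semigroup_lipschitz.
    by rewrite normrM (ger0_norm b0) mulrC.
  have dphi a : 0 <= a < t -> (fun u => (phi (a + u) - phi a) / u) @ 0^'+ -->
      sg * (P a (G f) x - G f x).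
    move=> /andP[a0 _].
    have : (fun u => sg * ((P (a + u) f x - P a f x) / u - G f x)) @ 0^'+ -->
      sg * (P a (G f) x - G f x).
      apply: cvgMr; apply: cvgB; last exact: cvg_cst.
      exact: semigroup_derivative.
    apply: cvg_trans; apply: near_eq_cvg.
    have : \forall t \near (0 : R)^'+, 0 < t by exact: nbhs_right_gt.
    by apply: filterS => u u0; rewrite /phi; field; rewrite gt_eqF.
  have dle a : 0 <= a < t -> sg * (P a (G f) x - G f x) <= 4 * C ^+ 2 * M * t.
    move=> /bG; apply: le_trans; rewrite (le_trans (ler_norm _))//.
    by rewrite normrM sg1 mul1r.
  have := right_derivative_le t0 Lphi dphi dle.
  by rewrite /phi P0; lra.
have := H 1 (normr1 _); have := H (-1) (normrN1 _).
by rewrite ler_norml; move=> *; apply/andP; split; lra.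
Qed.

End transition_semigroup.

(** * The Euler scheme of the killed chain *)

Section euler_scheme.
Variables (R : realType) (F : choiceType).
Variables (q : F -> F -> R) (p0 : F -> R) (qb pb l D : R).
Implicit Types (f g h u : F -> R).

(** The rates at which chains at [i] and [i'] can be made to jump together to a third site. The
    sites [i] and [i'] are excluded since a jump of one chain onto the other is counted
    separately. *)
Definition overlap i i' : F -> R := fun j =>
  if (j == i) || (j == i') then 0 else Num.min (q i j) (q i' j).

(** Real constants replace the extended suprema and infima of the statement; [l] is only a lower
    bound for [lambda], which is [+oo] when there is a single site. *)
Record coalescing_rates : Prop := CoalescingRates {
  rates_weight : forall i, summable_weight (q i);
  rates_total : forall i, rsum (q i) <= qb;
  killing_ge0 : forall i, 0 <= p0 i;
  killing_le : forall i, p0 i <= pb;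
  killing_osc : forall i i', p0 i - p0 i' <= D;
  rates_overlap : forall i i', i != i' ->
    l <= q i i' + q i' i + rsum (overlap i i');
  osc_ge0 : 0 <= D;
  osc_lt : D < l }.

Hypothesis Hq : coalescing_rates.
Let wq := rates_weight Hq.

(** The killed generator on functions vanishing at the cemetery, which then need not appear in the
    state space. *)
Definition killed f i := rsum (fun j => q i j * (f j - f i)) - p0 i * f i.

Definition euler e f i := f i + e * killed f i.

Let bsub f i : bounded f -> bounded (fun j => f j - f i).
Proof. by move=> bf; exact: boundedB. Qed.
Hint Resolve bsub : core.

Lemma killedB f g i : bounded f -> bounded g ->
  killed (fun j => f j - g j) i = killed f i - killed g i.
Proof.
move=> bf bg; rewrite /killed (@eq_rsum _ _ _
  (fun j => q i j * ((f j - f i) - (g j - g i)))); last by move=> j; congr (_ * _); ring.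
by rewrite wsumB//; [ring|exact: bsub..].
Qed.

Lemma killedZ k f i : bounded f -> killed (fun j => k * f j) i = k * killed f i.
Proof.
move=> bf; rewrite /killed (@eq_rsum _ _ _
  (fun j => q i j * (k * (f j - f i)))); last by move=> j; congr (_ * _); ring.
by rewrite wsumZ//; [ring|exact: bsub].
Qed.

Lemma killed_norm f i (M : R) : (forall j, `|f j| <= M) ->
  `|killed f i| <= (2 * qb + pb) * M.
Proof.
move=> fM; have M0 : 0 <= M by apply: le_trans (fM i).
rewrite /killed (le_trans (ler_normB _ _))// mulrDl lerD//.
  apply: le_trans (wsum_norm (wq i) (M := 2 * M) _) _.
    by move=> j _; rewrite (le_trans (ler_normB _ _))// mulr2n mulrDl mul1r lerD.
  have -> : 2 * qb * M = 2 * M * qb by ring.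
  by rewrite ler_wpM2l ?mulr_ge0// (rates_total Hq).
by rewrite normrM ler_pM// ger0_norm ?(killing_ge0 Hq)// (killing_le Hq).
Qed.

Lemma killed_bounded f : bounded f -> bounded (killed f).
Proof. by move=> [M fM]; exists ((2 * qb + pb) * M) => i; exact: killed_norm. Qed.

Variable e : R.
Hypothesis e0 : 0 <= e.
Hypothesis he : e * (2 * qb + pb + l) <= 1.
Local Notation K := (euler e).

Let qb_ge0 (i : F) : 0 <= qb.
Proof. by apply: le_trans (rates_total Hq i); apply: ge0_rsum; exact: (wq i).1. Qed.

Let l0 : 0 < l. Proof. exact: le_lt_trans (osc_ge0 Hq) (osc_lt Hq). Qed.

Lemma eulerB f g : bounded f -> bounded g ->
  K (fun j => f j - g j) = (fun i => K f i - K g i).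
Proof. by move=> bf bg; apply/funext => i; rewrite /euler killedB//; ring. Qed.

Lemma eulerZ k f : bounded f -> K (fun j => k * f j) = (fun i => k * K f i).
Proof. by move=> bf; apply/funext => i; rewrite /euler killedZ//; ring. Qed.

Lemma euler_bounded f : bounded f -> bounded (K f).
Proof. by move=> bf; apply/boundedD => //; apply/boundedZ/killed_bounded. Qed.
Hint Resolve euler_bounded : core.

Lemma euler_cst k i : K (fun=> k) i = k * (1 - e * p0 i).
Proof.
rewrite /euler /killed (@eq_rsum _ _ _ (fun=> 0)) ?rsum0; first by ring.
by move=> j; rewrite subrr mulr0.
Qed.

Lemma eulerE f i : bounded f -> K f i =
  (1 - e * (p0 i + rsum (q i))) * f i + e * rsum (fun j => q i j * f j).
Proof. by move=> bf; rewrite /euler /killed wsumB// (wsum_cst (wq i)); ring. Qed.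

Lemma rates_le_total i j : q i j <= rsum (q i).
Proof.
rewrite -(rsum_delta j (q i)); apply: ler_rsum; [exact: summ_delta|exact: (wq i).2|].
by move=> k; rewrite ler_piMl ?(wq i).1//; case: eqP.
Qed.

(** This is the purpose of [he]: the probability of staying put exceeds that of any single jump, by
    [e * qb], and also covers the rate [l] when the two chains already coincide. *)
Let diag_ge i : e * qb + e * l <= 1 - e * (p0 i + rsum (q i)).
Proof.
have := ler_wpM2l e0 (rates_total Hq i).
have := ler_wpM2l e0 (killing_le Hq i).
by move: he; rewrite !mulrDr; lra.
Qed.

Let diag_ge_rate i i' j : e * q i' j <= 1 - e * (p0 i + rsum (q i)).
Proof.
apply: le_trans (diag_ge i); rewrite -[leLHS]addr0 lerD ?mulr_ge0 ?(ltW l0)//.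
by rewrite ler_wpM2l// (le_trans (rates_le_total i' j))// rates_total.
Qed.

Lemma euler_ge0 f : bounded f -> (forall j, 0 <= f j) -> forall i, 0 <= K f i.
Proof.
move=> bf f0 i; rewrite eulerE// addr_ge0// mulr_ge0//.
  by apply: le_trans (diag_ge i); rewrite addr_ge0 ?mulr_ge0 ?(ltW l0) ?(qb_ge0 i).
by apply: ge0_rsum => j; rewrite mulr_ge0// (wq i).1.
Qed.

Lemma ler_euler f g : bounded f -> bounded g -> (forall j, f j <= g j) ->
  forall i, K f i <= K g i.
Proof.
move=> bf bg fg i; rewrite -subr_ge0 -[leRHS]/((fun i => K g i - K f i) i) -eulerB//.
by apply: euler_ge0 => [|j]; [exact: boundedB|rewrite subr_ge0].
Qed.

Lemma euler_le_cst f k : 0 <= k -> bounded f -> (forall j, f j <= k) ->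
  forall i, K f i <= k.
Proof.
move=> k0 bf fk i; apply: (le_trans (ler_euler bf (@bounded_cst R F k) fk i)).
by rewrite euler_cst ler_piMr// gerBl mulr_ge0// (killing_ge0 Hq).
Qed.

Lemma euler_norm f (M : R) : (forall j, `|f j| <= M) -> forall i, `|K f i| <= M.
Proof.
move=> fM i; have M0 : 0 <= M by apply: le_trans (fM i).
have bf : bounded f by exists M.
have fM' j : - M <= f j <= M by rewrite -ler_norml.
rewrite ler_norml euler_le_cst// ?andbT => [|j]; last by case/andP: (fM' j).
have := euler_le_cst M0 (boundedN bf) (fun j => _) i.
have -> : K (fun x => - f x) i = - K f i.
  rewrite (_ : (fun x => - f x) = (fun x => -1 * f x)).
    by rewrite eulerZ//= mulN1r.
  by apply/funext => x; rewrite mulN1r.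
by rewrite lerNl; apply => j; rewrite lerNl; case/andP: (fM' j).
Qed.

(* The two chains started from [i] and [i'] coalesce during a step with
   probability at least [e * l]. *)
Lemma euler_overlap f g m i i' : 0 <= m -> bounded f -> bounded g ->
  (forall j, 0 <= f j) -> (forall j, 0 <= g j) ->
  (forall j, m <= f j + g j) -> e * l * m <= K f i + K g i'.
Proof.
move=> m0 bf bg f0 g0 fg; rewrite !eulerE//.
have [<-|ii'] := eqVneq i i'.
  rewrite addrACA -mulrDr; apply: (@le_trans _ _ (e * l * (f i + g i))).
    by rewrite ler_wpM2l// mulr_ge0// ltW.
  rewrite -[leLHS]addr0 lerD//.
    apply: ler_wpM2r; first by rewrite addr_ge0.
    by apply: le_trans (diag_ge i); rewrite lerDr mulr_ge0// (qb_ge0 i).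
  by rewrite addr_ge0// mulr_ge0// ge0_rsum// => j; rewrite mulr_ge0// (wq _).1.
pose o := overlap i i'.
have o0 j : 0 <= o j.
  by rewrite /o /overlap; case: ifP => // _; rewrite le_min !(wq _).1.
have wo : summable_weight o.
  split => //; apply: summ_le (wq i).2 => j; rewrite ger0_norm//.
  by rewrite /o /overlap; case: ifP => _; rewrite ?(wq _).1// ge_min lexx.
(* The jump onto the other chain and the common jumps use disjoint parts of the row, because the
   overlap vanishes at [k']. *)
have lower k k' (u : F -> R) : k != k' -> bounded u -> (forall j, 0 <= u j) ->
    (forall j, o j <= q k j) -> o k' = 0 ->
    q k k' * u k' + rsum (fun j => o j * u j) <= rsum (fun j => q k j * u j).
  move=> kk' bu u0 ok ok'.
  rewrite -(rsum_delta k' (fun j => q k j * u j)) -rsumD; last 2 first.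
  - exact: summ_delta.
  - exact: wsumm.
  apply: ler_rsum.
  - by apply: summD; [exact: summ_delta|exact: wsumm].
  - exact: wsumm.
  move=> j; case: (eqVneq j k') => [->|_]; rewrite ?ok' ?mul1r ?mul0r ?addr0// add0r.
  by rewrite ler_wpM2r.
have Hf : q i i' * f i' + rsum (fun j => o j * f j) <= rsum (fun j => q i j * f j).
  apply: lower => // [j|]; last by rewrite /o /overlap eqxx orbT.
  by rewrite /o /overlap; case: ifP => _; rewrite ?(wq _).1// ge_min lexx.
have Hg : q i' i * g i + rsum (fun j => o j * g j) <= rsum (fun j => q i' j * g j).
  apply: lower => // [|j|]; first by rewrite eq_sym.
    by rewrite /o /overlap; case: ifP => _; rewrite ?(wq _).1// ge_min lexx orbT.
  by rewrite /o /overlap eqxx.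
have Ho : m * rsum o <= rsum (fun j => o j * f j) + rsum (fun j => o j * g j).
  rewrite -wsumD// -(wsum_cst wo); apply: ler_wsum => //; exact: boundedD.
have Hl := rates_overlap Hq ii'.
(* When one chain jumps onto the other, the latter must stay: the diagonal mass at [i] pays for the
   jump from [i'] to [i], and conversely. *)
have Di := ler_wpM2r (f0 i) (diag_ge_rate i i' i).
have Di' := ler_wpM2r (g0 i') (diag_ge_rate i' i i').
have E1 : q i i' * m <= q i i' * (f i' + g i') by rewrite ler_wpM2l// (wq _).1.
have E2 : q i' i * m <= q i' i * (f i + g i) by rewrite ler_wpM2l// (wq _).1.
have E3 : l * m <= (q i i' + q i' i + rsum o) * m by rewrite ler_wpM2r.
have E4 : l * m <= q i' i * f i + q i i' * g i' +
    (rsum (fun j => q i j * f j) + rsum (fun j => q i' j * g j)) by lra.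
by have := ler_wpM2l e0 E4; lra.
Qed.

Definition ratio_bound : R := 1 - D / l.
Local Notation c := ratio_bound.

Lemma ratio_bound_gt0 : 0 < c.
Proof. by rewrite subr_gt0 ltr_pdivrMr// mul1r (osc_lt Hq). Qed.

Lemma ratio_bound_le1 : c <= 1.
Proof. by rewrite gerBl divr_ge0 ?(osc_ge0 Hq) ?(ltW l0). Qed.

Record comparable_values h : Prop := ComparableValues {
  comparable_bounded : bounded h;
  comparable_gt0 : forall i, 0 < h i;
  comparable_ratio : forall i i', c * h i' <= h i }.

(** The supremum, attained or not, is a single constant to compare all values with; [i] makes the
    range nonempty. *)
Lemma comparable_sup h (i : F) : comparable_values h ->
  exists2 M, 0 < M & forall j, c * M <= h j <= M.
Proof.
move=> [[B hB] h0 ch]; pose M := sup (range h).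
have sM : has_sup (range h).
  by split; [exists (h i), i|exists B => _ [j _ <-]; rewrite (le_trans (ler_norm _))].
have hM j : h j <= M by apply: ub_le_sup; [exact: sM.2|exists j].
exists M => [|j]; first exact: lt_le_trans (h0 i) (hM i).
rewrite hM andbT mulrC -ler_pdivlMr ?ratio_bound_gt0//.
apply: ge_sup; first exact: sM.1.
by move=> _ [k _ <-]; rewrite ler_pdivlMr ?ratio_bound_gt0// mulrC.
Qed.

(* [euler_overlap] for [h - c M] and [M - h]: the gain [(1 - c) l = D] exactly
   compensates for the oscillation of the killing rate. *)
Lemma euler_comparable h : comparable_values h -> comparable_values (K h).
Proof.
move=> ch; have [bh h0 _] := ch.
have c0 := ratio_bound_gt0.
split; first exact: euler_bounded.
  move=> i; rewrite eulerE// ltr_pwDl//.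
    rewrite mulr_gt0//; have := diag_ge i.
    have [e00|e00] := eqVneq e 0; first by rewrite e00 !mul0r subr0.
    apply: lt_le_trans; rewrite ltr_wpDl ?mulr_ge0 ?(qb_ge0 i)//.
    by rewrite mulr_gt0// lt0r e00.
  by rewrite mulr_ge0// ge0_rsum// => j; rewrite mulr_ge0 ?(wq _).1// ltW.
move=> i i'; have [M M0 hM] := comparable_sup i ch.
have c1 := ratio_bound_le1.
pose f j := h j - c * M; pose g j := M - h j.
have bf : bounded f by exact: boundedB.
have bg : bounded g by exact: boundedB.
have f0 j : 0 <= f j by rewrite subr_ge0; case/andP: (hM j).
have g0 j : 0 <= g j by rewrite subr_ge0; case/andP: (hM j).
have := @euler_overlap f g ((1 - c) * M) i i' _ bf bg f0 g0 _.
have -> : K f i = K h i - c * M * (1 - e * p0 i).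
  by rewrite /f eulerB// euler_cst.
have Kg : K g i' = M * (1 - e * p0 i') - K h i'.
  by rewrite /g eulerB// euler_cst.
have Kg0 : 0 <= K g i' by exact: euler_ge0.
move=> H; have {}H : e * l * ((1 - c) * M) <= K h i - c * M * (1 - e * p0 i) + K g i'.
  apply: H; first by rewrite mulr_ge0 ?subr_ge0 ?(ltW M0).
  by move=> j; rewrite /f /g; lra.
have Kf0 : 0 <= K h i - c * M * (1 - e * p0 i).
  have <- : K f i = K h i - c * M * (1 - e * p0 i) by rewrite /f eulerB// euler_cst.
  exact: euler_ge0.
have lc : l * (1 - c) = D by rewrite /c opprB addrC subrK mulrC divfK// gt_eqF.
have E : e * D * M <= K h i - c * M * (1 - e * p0 i) + K g i'.
  by move: H; rewrite -lc; lra.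
(* In [K f i + c * K g i'] the two terms [c * M] cancel, leaving [K h i - c * K h i'] and the
   killing difference [c * (e * M) * (p0 i - p0 i')]. This sum is at least [c * e * D * M] by [E],
   since [c <= 1] and [K f i >= 0]. *)
have p : c * (e * M) * (p0 i - p0 i') <= c * (e * M) * D.
  by rewrite ler_wpM2l ?(killing_osc Hq)// !mulr_ge0 ?(ltW c0) ?(ltW M0).
have E1 := ler_wpM2l (ltW c0) E.
have c1' : 0 <= 1 - c by rewrite subr_ge0.
have E2 := mulr_ge0 c1' Kf0.
by move: E1; rewrite Kg; lra.
Qed.

Definition ratio_osc h u d := forall i i', u i / h i - u i' / h i' <= d.

(** With [a] the infimum of the ratios, the oscillation bound becomes a pair of linear inequalities,
    to which the positivity of the Euler operator applies. *)
Lemma ratio_osc_affine h u d (i : F) : (forall j, 0 < h j) -> ratio_osc h u d ->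
  exists a, forall j, a * h j <= u j <= (a + d) * h j.
Proof.
move=> h0 hu; pose r j := u j / h j; pose a := inf (range r).
have ia : has_inf (range r).
  split; first by exists (r i), i.
  by exists (r i - d) => _ [j _ <-]; have := hu i j; rewrite /r; lra.
have ra j : a <= r j by apply: ge_inf; [exact: ia.2|exists j].
have ar j : r j - d <= a.
  apply: lb_le_inf; first exact: ia.1.
  by move=> _ [k _ <-]; have := hu j k; rewrite /r; lra.
exists a => j; rewrite -ler_pdivlMr// -/(r j) ra -ler_pdivrMr//.
by rewrite -lerBlDr ar.
Qed.

(* With [a h <= u <= (a + d) h], [euler_overlap] is used for [(a + d) h - u] and
   [u - a h], whose sum [d h] is at least [d c M]. *)
Lemma euler_ratio_osc h u d : 0 <= d -> comparable_values h -> bounded u ->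
  ratio_osc h u d -> ratio_osc (K h) (K u) (d * (1 - e * (c * l))).
Proof.
move=> d0 ch bu hu i i'; have [bh h0 _] := ch; have [_ Kh0 _] := euler_comparable ch.
have [M M0 hM] := comparable_sup i ch.
have [a ua] := ratio_osc_affine i h0 hu.
pose v j := u j - a * h j; pose w j := (a + d) * h j - u j.
have bah k : bounded (fun j => k * h j) by exact: boundedZ.
have bv : bounded v by exact: boundedB.
have bw : bounded w by exact: boundedB.
have v0 j : 0 <= v j by rewrite subr_ge0; case/andP: (ua j).
have w0 j : 0 <= w j by rewrite subr_ge0; case/andP: (ua j).
have c0 := ratio_bound_gt0.
have := @euler_overlap w v (d * (c * M)) i i' _ bw bv w0 v0 _.
move=> H; have {}H : e * l * (d * (c * M)) <= K w i + K v i'.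
  apply: H; first by rewrite !mulr_ge0 ?(ltW c0) ?(ltW M0).
  move=> j; rewrite /v /w; have /andP[cM _] := hM j.
  by have := ler_wpM2l d0 cM; lra.
(* Killing does not let [h] grow, so dividing by [M] instead of [K h] gives a lower bound, and this
   [M] cancels the one produced by [euler_overlap]. *)
have KhM k : K h k <= M.
  by apply: euler_le_cst => // [|j]; [exact: ltW|case/andP: (hM j)].
have Kw : K w i / K h i = a + d - K u i / K h i.
  by rewrite /w eulerB// eulerZ//; field; rewrite gt_eqF.
have Kv : K v i' / K h i' = K u i' / K h i' - a.
  by rewrite /v eulerB// eulerZ//; field; rewrite gt_eqF.
have invM k : M^-1 <= (K h k)^-1 by rewrite lef_pV2// posrE.
have Kw0 := euler_ge0 bw w0 i; have Kv0 := euler_ge0 bv v0 i'.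
have Ew : K w i / M <= K w i / K h i by rewrite ler_wpM2l.
have Ev : K v i' / M <= K v i' / K h i' by rewrite ler_wpM2l.
have : (e * l * (d * (c * M))) / M <= (K w i + K v i') / M.
  by rewrite ler_wpM2r// invr_ge0 ltW.
have -> : (e * l * (d * (c * M))) / M = d * (e * (c * l)).
  by field; rewrite gt_eqF.
by rewrite mulrDl; lra.
Qed.

Section iterates.
Variable phi : F -> R.
Hypothesis phi1 : forall i, `|phi i| <= 1.

Lemma iter_euler_bounded f n : bounded f -> bounded (iter n K f).
Proof. by move=> bf; elim: n => [//|n ih] /=; exact: euler_bounded. Qed.

Lemma iter_euler_comparable n : comparable_values (iter n K (fun=> 1)).
Proof.
elim: n => [|n ih] /=; last exact: euler_comparable.
by split => //= i i'; rewrite mulr1 ratio_bound_le1.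
Qed.

Lemma iter_euler_norm n i : `|iter n K phi i| <= iter n K (fun=> 1) i.
Proof.
have bphi : bounded phi by exists 1.
elim: n i => [|n ih] //= i.
have b1 := @iter_euler_bounded (fun=> 1) n (@bounded_cst R F 1).
have bu := @iter_euler_bounded phi n bphi.
have H j : - iter n K (fun=> 1) j <= iter n K phi j <= iter n K (fun=> 1) j.
  by rewrite -ler_norml.
rewrite ler_norml; apply/andP; split; last first.
  by apply: ler_euler => // j; case/andP: (H j).
rewrite -[leLHS]mulN1r -[leLHS]/((fun i => -1 * K (iter n K (fun=> 1)) i) i) -eulerZ//.
by apply: ler_euler => // [|j]; [exact: boundedZ|rewrite mulN1r; case/andP: (H j)].
Qed.

Lemma contraction_ge0 (i : F) : 0 <= 1 - e * (c * l).
Proof.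
have el0 : 0 <= e * l by rewrite mulr_ge0// ltW.
have : c * (e * l) <= e * l by rewrite ler_piMl// ratio_bound_le1.
have qe0 : 0 <= e * qb by rewrite mulr_ge0// (qb_ge0 i).
have r0 : 0 <= e * (p0 i + rsum (q i)).
  by rewrite mulr_ge0// addr_ge0 ?(killing_ge0 Hq)// ge0_rsum//; exact: (wq i).1.
by have := diag_ge i; lra.
Qed.

Lemma iter_euler_ratio_osc n :
  ratio_osc (iter n K (fun=> 1)) (iter n K phi) (2 * (1 - e * (c * l)) ^+ n).
Proof.
have bphi : bounded phi by exists 1.
move=> i i'; elim: n i i' => [|n ih] /= i i'.
  rewrite expr0 !divr1 mulr1.
  have := phi1 i; have := phi1 i'; rewrite !ler_norml => /andP[? ?] /andP[? ?]; lra.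
rewrite exprSr mulrA; apply: euler_ratio_osc => //.
- by rewrite mulr_ge0// exprn_ge0// (contraction_ge0 i).
- exact: iter_euler_comparable.
- exact: iter_euler_bounded.
Qed.

End iterates.

End euler_scheme.

(** * One step of the particle system *)

Section particle_step.
Variables (R : realType) (F : choiceType).
Variables (q : F -> F -> R) (p0 : F -> R) (qb pb l D : R).
Hypothesis Hq : coalescing_rates q p0 qb pb l D.
Variables (n : R) (mu : F -> R).
Hypothesis n2 : 2 <= n.
Hypothesis wmu : summable_weight mu.
Hypothesis mu1 : rsum mu = 1.
Implicit Types (f h u w : F -> R) (B M : R).

Local Notation m f := (rsum (fun j => mu j * f j)).
Local Notation G := (killed q p0).
Local Notation K := (euler q p0).
Local Notation c := (ratio_bound l D).

(** For an empirical distribution [mu], [n * mu j] is the number of particles at [j]. Integrality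
    plays no part in this section. *)
Definition particle_rate (i j : F) : R := q i j + p0 i * (n * mu j / (n - 1)).
Local Notation a := particle_rate.

(** [g i j] stands for the increment of a function when a particle jumps from [i] to [j], so that
    the estimates need no configurations. *)
Definition particle_generator (g : F -> F -> R) : R :=
  rsum (fun i => n * mu i * rsum (fun j => a i j * g i j)).
Local Notation J := particle_generator.

Let n0 : 0 < n. Proof. exact: lt_le_trans n2. Qed.
Let n10 : 0 < n - 1. Proof. by move: n2; lra. Qed.
Let mu0 i : 0 <= mu i. Proof. exact: wmu.1. Qed.
Let p00 i : 0 <= p0 i. Proof. exact: killing_ge0 Hq i. Qed.
Let wq i : summable_weight (q i). Proof. exact: rates_weight Hq i. Qed.

Let wn : summable_weight (fun i => n * mu i).
Proof. by split => [i|]; [rewrite mulr_ge0// ltW|exact/summZ/wmu.2]. Qed.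

Let rsum_n : rsum (fun i => n * mu i) = n.
Proof. by rewrite rsumZ ?mu1 ?mulr1//; exact: wmu.2. Qed.

Let ex_state := rsum_eq1_neq0 mu1.

Let pb0 : 0 <= pb.
Proof. by have [i _] := ex_state; exact: le_trans (p00 i) (killing_le Hq i). Qed.

Let qb0 : 0 <= qb.
Proof.
have [i _] := ex_state; apply: le_trans (rates_total Hq i).
by apply: ge0_rsum; exact: (wq i).1.
Qed.

Lemma mean_norm f M : (forall j, `|f j| <= M) -> `|m f| <= M.
Proof. by move=> fM; have := wsum_norm wmu (fun j _ => fM j); rewrite mu1 mulr1. Qed.

Lemma mean_ge f k : bounded f -> (forall j, k <= f j) -> k <= m f.
Proof.
move=> bf kf; rewrite -[leLHS]mulr1 -mu1 -(wsum_cst wmu).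
exact: ler_wsum.
Qed.

Lemma mean_ratio_le1 h u : bounded h -> (forall j, `|u j| <= h j) -> 0 < m h ->
  `|m u / m h| <= 1.
Proof.
move=> bh uh mh0.
have bu : bounded u.
  by have [B hB] := bh; exists B => j; apply: le_trans (uh j) (le_trans (ler_norm _) (hB j)).
rewrite normrM normfV (gtr0_norm mh0) ler_pdivrMr// mul1r.
have H j : - h j <= u j <= h j by rewrite -ler_norml.
rewrite ler_norml; apply/andP; split; last first.
  by apply: ler_wsum => // j _; case/andP: (H j).
rewrite -[leLHS]mulN1r -(wsumZ wmu)//; apply: ler_wsum => //; first exact: boundedZ.
by move=> j _; rewrite mulN1r; case/andP: (H j).
Qed.

Lemma particle_rateE i : (fun j => p0 i * (n * mu j / (n - 1))) =
  (fun j => p0 i * (n / (n - 1)) * mu j).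
Proof. by apply/funext => j; field; rewrite gt_eqF. Qed.

Lemma particle_rate_weight i : summable_weight (a i).
Proof.
split => [j|].
  by rewrite addr_ge0 ?(wq i).1// mulr_ge0// divr_ge0 ?(ltW n10)// mulr_ge0// ltW.
by apply: summD; [exact: (wq i).2|rewrite particle_rateE; exact/summZ/wmu.2].
Qed.

Lemma particle_rate_total i : rsum (a i) <= qb + 2 * pb.
Proof.
rewrite /particle_rate rsumD; [|exact: (wq i).2|].
  rewrite lerD ?(rates_total Hq)// particle_rateE rsumZ; last exact: wmu.2.
  rewrite mu1 mulr1 mulrC; apply: ler_pM => //; last exact: killing_le Hq i.
    by rewrite divr_ge0// ltW.
  by rewrite ler_pdivrMr//; move: n2; lra.
by rewrite particle_rateE; exact/summZ/wmu.2.
Qed.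

Lemma particle_generator_norm (g : F -> F -> R) B : 0 <= B ->
  (forall i j, mu i != 0 -> `|g i j| <= B) -> `|J g| <= (qb + 2 * pb) * B * n.
Proof.
move=> B0 gB; rewrite -[X in _ * X]rsum_n; apply: (wsum_norm wn) => i.
rewrite mulf_eq0 negb_or => /andP[_ mui].
apply: le_trans (wsum_norm (particle_rate_weight i) (fun j _ => gB i j mui)) _.
by rewrite mulrC ler_wpM2r// particle_rate_total.
Qed.

Lemma particle_generator_bounded (g : F -> F -> R) B : (forall i j, `|g i j| <= B) ->
  bounded (fun i => rsum (fun j => a i j * g i j)).
Proof.
move=> gB; exists ((qb + 2 * pb) * B) => i; have B0 : 0 <= B by apply: le_trans (gB i i).
apply: le_trans (wsum_norm (particle_rate_weight i) (fun j _ => gB i j)) _.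
by rewrite mulrC ler_wpM2r// particle_rate_total.
Qed.

Lemma particle_generatorD (g g' : F -> F -> R) B B' :
  (forall i j, `|g i j| <= B) -> (forall i j, `|g' i j| <= B') ->
  J (fun i j => g i j + g' i j) = J g + J g'.
Proof.
move=> gB gB'; rewrite -(wsumD wn); [|exact: particle_generator_bounded gB
  |exact: particle_generator_bounded gB'].
apply: eq_rsum => i; rewrite -(wsumD (particle_rate_weight i)) //.
  by exists B. by exists B'.
Qed.

Lemma particle_generatorZ k (g : F -> F -> R) B : (forall i j, `|g i j| <= B) ->
  J (fun i j => k * g i j) = k * J g.
Proof.
move=> gB; rewrite -(wsumZ wn); last exact: particle_generator_bounded gB.
apply: eq_rsum => i; congr (_ * _).
by rewrite (wsumZ (particle_rate_weight i))//; exists B.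
Qed.

Lemma eq_particle_generator (g g' : F -> F -> R) :
  (forall i j, mu i != 0 -> g i j = g' i j) -> J g = J g'.
Proof.
move=> gg; apply: eq_rsum => i; have [->|mui] := eqVneq (mu i) 0.
  by rewrite mulr0 !mul0r.
by congr (_ * _); apply: eq_rsum => j; rewrite gg.
Qed.

(* The jumps towards other particles reproduce the killing term of [G] up to
   a factor [n / (n - 1)]. *)
Lemma particle_generator_linear w : bounded w -> m w = 0 ->
  J (fun i j => w j - w i) = n * m (G w) - n / (n - 1) * m (fun j => p0 j * w j).
Proof.
move=> bw mw; have bsub i : bounded (fun j => w j - w i) by exact: boundedB.
have bp0 : bounded p0.
  by exists pb => i; rewrite ger0_norm// (killing_le Hq).
have bG := killed_bounded Hq bw.
have bpw := boundedM bp0 bw.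
transitivity (rsum (fun i => n * (mu i * (G w i - (n - 1)^-1 * (p0 i * w i))))).
  apply: eq_rsum => i; rewrite -mulrA; congr (_ * (_ * _)).
  rewrite (@eq_rsum _ _ _ (fun j => q i j * (w j - w i) +
    p0 i * (n / (n - 1)) * (mu j * (w j - w i)))); last first.
    by move=> j; rewrite /particle_rate; field; rewrite gt_eqF.
  rewrite rsumD; [|exact: wsumm|exact/summZ/wsumm].
  rewrite rsumZ ?(wsumB wmu)// ?(wsum_cst wmu) ?mw ?mu1; last exact: wsumm.
  by rewrite /killed; field; rewrite gt_eqF.
have bZ : bounded (fun i => (n - 1)^-1 * (p0 i * w i)) by exact: boundedZ.
rewrite rsumZ; last by apply: wsumm => //; exact: boundedB.
rewrite (wsumB wmu)// (wsumZ wmu)//; field; by rewrite gt_eqF.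
Qed.

Variables (e : R) (h u : F -> R) (M d k : R).
Hypothesis e0 : 0 <= e.
Hypothesis he : e * (2 * qb + pb + l) <= 1.
Hypothesis epb : e * pb <= 1 / 2.
Hypothesis M0 : 0 < M.
Hypothesis hM : forall j, c * M <= h j <= M.
Hypothesis uh : forall j, `|u j| <= h j.
Hypothesis d0 : 0 <= d.
Hypothesis d2 : d <= 2.
Hypothesis ud : ratio_osc h u d.
Hypothesis k1 : `|k| <= 1.
Let x0 := m u / m h.
Let D_ i j := m h + (h j - h i) / n.
Hypothesis DM : forall i j, mu i != 0 -> c * M <= D_ i j.

Let x i j := (m u + (u j - u i) / n) / D_ i j.

(** The three terms bound the second-order part of the jumps ([n] particles, total rate
    [qb + 2 * pb], remainder [zle]), the excess of [n / (n - 1)] over [1] in the killing term, and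
    the replacement of [m (K e h)] by [m h] in the drift. *)
Definition particle_error : R :=
  (16 * (qb + 2 * pb) / c ^+ 2 + 8 * pb / c) * d / n + 16 * (2 * qb + pb) ^+ 2 / c ^+ 2 * e.

Let c0 : 0 < c. Proof. exact: ratio_bound_gt0 Hq. Qed.
Let cM0 : 0 < c * M. Proof. exact: mulr_gt0. Qed.
Let h0 j : 0 < h j. Proof. by apply: lt_le_trans cM0 _; case/andP: (hM j). Qed.
Let hle j : h j <= M. Proof. by case/andP: (hM j). Qed.
Let bh : bounded h. Proof. by exists M => j; rewrite ger0_norm// ltW. Qed.
Let bu : bounded u.
Proof. by exists M => j; exact: le_trans (uh j) (hle j). Qed.
Let mh : c * M <= m h.
Proof. by apply: mean_ge => // j; case/andP: (hM j). Qed.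
Let mh0 : 0 < m h. Proof. exact: lt_le_trans mh. Qed.

Let w j := u j - x0 * h j.
Let bw : bounded w. Proof. by apply: boundedB => //; exact: boundedZ. Qed.

Let mw : m w = 0.
Proof.
rewrite /w (wsumB wmu)//; last exact: boundedZ.
by rewrite (wsumZ wmu)// /x0 divfK ?subrr// gt_eqF.
Qed.

(** [x0] is the average of the ratios [u / h] with weights [mu * h], so it lies in the same interval
    of length [d] as they do. *)
Let wM j : `|w j| <= M * d.
Proof.
have [b ub] := ratio_osc_affine j h0 ud.
have bx : b <= x0.
  rewrite ler_pdivlMr// -(wsumZ wmu)//; apply: ler_wsum => //.
    exact: boundedZ.
  by move=> i _; case/andP: (ub i).
have xb : x0 <= b + d.
  rewrite ler_pdivrMr// -(wsumZ wmu)//; apply: ler_wsum => //.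
    exact: boundedZ.
  by move=> i _; case/andP: (ub i).
have /andP[u1 u2] := ub j.
have hd : h j * d <= M * d by rewrite ler_wpM2r.
apply: le_trans hd; rewrite ler_norml /w.
have B1 := ler_wpM2r (ltW (h0 j)) bx; have B2 := ler_wpM2r (ltW (h0 j)) xb.
by apply/andP; split; lra.
Qed.

Let x01 : `|x0| <= 1. Proof. exact: mean_ratio_le1. Qed.

Let xk : `|x0 - k| <= 2.
Proof. by rewrite (le_trans (ler_normB _ _))// (natrD _ 1 1) lerD. Qed.

Let z i j := (x i j - k) ^+ 2 - (x0 - k) ^+ 2 -
  (2 * (x0 - k) / (n * m h)) * (w j - w i).

(** With [y] the increment of the ratio, the remainder is [2 (x0 - k) y y' + y^2], where [y y'] is
    the effect of replacing [D_ i j] by [m h]. Each half is at most [8 d / (n^2 c^2)]; in the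
    second, [d <= 2] turns [d^2] into [2 d]. *)
Let zle i j : mu i != 0 -> `|z i j| <= 16 * d / (n ^+ 2 * c ^+ 2).
Proof.
move=> mui; have DMij := DM j mui; have Dij := lt_le_trans cM0 DMij.
pose y := (w j - w i) / (n * D_ i j).
pose y' := (h i - h j) / (n * m h).
have xE : x i j = x0 + y.
  rewrite /x /y /w; have -> : m u = x0 * m h by rewrite divfK// gt_eqF.
  have Dij0 : D_ i j != 0 by rewrite gt_eqF.
  have -> : h j = h i + n * (D_ i j - m h).
    by rewrite /D_; field; rewrite gt_eqF.
  by field; rewrite Dij0 gt_eqF.
have zE : z i j = 2 * (x0 - k) * (y * y') + y ^+ 2.
  rewrite /z xE; have -> : y * y' = y - (w j - w i) / (n * m h).
    rewrite /y /y'; have -> : h i - h j = n * (m h - D_ i j).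
      by rewrite /D_; field; rewrite gt_eqF.
    by field; rewrite !gt_eqF.
  by field; rewrite !gt_eqF.
have wij : `|w j - w i| <= 2 * (M * d).
  by rewrite (le_trans (ler_normB _ _))// mulr2n mulrDl mul1r lerD.
have yle : `|y| <= 2 * d / (n * c).
  rewrite normrM normfV (gtr0_norm (mulr_gt0 n0 Dij)) ler_pdivrMr ?mulr_gt0//.
  apply: (le_trans wij); have -> : 2 * (M * d) = 2 * d / (n * c) * (n * (c * M)).
    by field; rewrite !gt_eqF.
  by rewrite ler_wpM2l ?ler_wpM2l ?divr_ge0 ?mulr_ge0 ?(ltW n0) ?(ltW c0).
have yle' : `|y'| <= 1 / (n * c).
  rewrite normrM normfV (gtr0_norm (mulr_gt0 n0 mh0)) ler_pdivrMr ?mulr_gt0//.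
  apply: (@le_trans _ _ M).
    rewrite ler_norml; have := hle i; have := hle j; have := h0 i; have := h0 j.
    by move=> *; apply/andP; split; lra.
  have -> : M = 1 / (n * c) * (n * (c * M)) by field; rewrite !gt_eqF.
  by rewrite ler_wpM2l ?ler_wpM2l ?divr_ge0 ?mulr_ge0 ?(ltW n0) ?(ltW c0).
have yy' : `|y * y'| <= 2 * d / (n ^+ 2 * c ^+ 2).
  rewrite normrM; apply: (le_trans (ler_pM (normr_ge0 _) (normr_ge0 _) yle yle')).
  by rewrite le_eqVlt; apply/orP; left; apply/eqP; field; rewrite !gt_eqF.
have y2 : y ^+ 2 <= 4 * d ^+ 2 / (n ^+ 2 * c ^+ 2).
  rewrite -(real_normK (num_real y)).
  have -> : 4 * d ^+ 2 / (n ^+ 2 * c ^+ 2) = (2 * d / (n * c)) ^+ 2.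
    by field; rewrite !gt_eqF.
  by rewrite lerXn2r ?nnegrE// divr_ge0 ?mulr_ge0 ?(ltW n0) ?(ltW c0).
rewrite zE (le_trans (ler_normD _ _))//.
have -> : 16 * d / (n ^+ 2 * c ^+ 2) = 2 * 2 * (2 * d / (n ^+ 2 * c ^+ 2)) +
  4 * (2 * d) / (n ^+ 2 * c ^+ 2) by field; rewrite !gt_eqF.
rewrite lerD//.
  by rewrite normrM ler_pM// normrM ler_pM// ger0_norm.
rewrite ger0_norm ?sqr_ge0//; apply: (le_trans y2).
apply: ler_wpM2r; first by rewrite invr_ge0 mulr_ge0 ?sqr_ge0.
by rewrite ler_wpM2l// expr2 ler_wpM2r.
Qed.

(** By [epb], a single step loses at most half of a constant function. *)
Let eK0 : 0 < m (K e h) /\ c * M / 2 <= m (K e h).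
Proof.
suff H : c * M / 2 <= m (K e h) by split => //; apply: lt_le_trans H; rewrite divr_gt0.
apply: mean_ge; first exact: (euler_bounded Hq).
move=> j; have := ler_euler Hq e0 he (@bounded_cst R F (c * M)) bh.
move=> /(_ (fun i => (andP (hM i)).1) j); apply: le_trans.
rewrite (euler_cst) ler_wpM2l ?(ltW cM0)//.
by have := ler_wpM2l e0 (killing_le Hq j); move: epb; lra.
Qed.

Let mKE f : bounded f -> m (K e f) = m f + e * m (G f).
Proof.
move=> bf; have bG := killed_bounded Hq bf.
by rewrite -(wsumZ wmu e bG) -(wsumD wmu bf (boundedZ e bG)).
Qed.

Let drift := m (G w) / m (K e h).

(** No second-order term appears: [u = x0 h + w] with [m w = 0], so [m (K e u)] is
    [x0 * m (K e h) + e * m (G w)]. *)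
Let euler_ratio : m (K e u) / m (K e h) = x0 + e * drift.
Proof.
have [mK _] := eK0; have bxh := boundedZ x0 bh.
rewrite /drift (mKE bu) (mKE bh).
rewrite (_ : m (G w) = rsum (fun j => mu j * (G u j - x0 * G h j))).
  have [bGu bGh] := (killed_bounded Hq bu, killed_bounded Hq bh).
  rewrite (wsumB wmu bGu (boundedZ x0 bGh)) (wsumZ wmu x0 bGh).
  have -> : m u = x0 * m h by rewrite divfK// gt_eqF.
  by move: mK; rewrite (mKE bh) => ?; field; rewrite gt_eqF.
by apply: eq_rsum => j; rewrite /w (killedB Hq)// (killedZ Hq).
Qed.

Let mG f (B : R) : (forall j, `|f j| <= B) -> `|m (G f)| <= (2 * qb + pb) * B.
Proof. by move=> fB; apply: mean_norm => j; exact: (killed_norm Hq j fB). Qed.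

Let drift_error : `|m (G w) / m h - drift| <= 4 * (2 * qb + pb) ^+ 2 / c ^+ 2 * e.
Proof.
have [mK mK2] := eK0.
have -> : m (G w) / m h - drift = e * (m (G w) * m (G h)) / (m h * m (K e h)).
  by rewrite /drift; move: mK; rewrite (mKE bh) => ?; field; rewrite !gt_eqF.
have Gw := mG wM.
have Gh : `|m (G h)| <= (2 * qb + pb) * M by apply: mG => j; rewrite ger0_norm// ltW.
rewrite normrM normfV [X in _ / X]gtr0_norm ?mulr_gt0// ler_pdivrMr ?mulr_gt0//.
rewrite normrM (ger0_norm e0).
apply: (@le_trans _ _ (4 * (2 * qb + pb) ^+ 2 / c ^+ 2 * e * (c * M * (c * M / 2)))); last first.
  rewrite ler_wpM2l//; last by rewrite ler_pM// ?divr_ge0// ltW.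
  by rewrite !mulr_ge0// ?invr_ge0 ?exprn_ge0 ?(ltW c0)// addr_ge0 ?mulr_ge0.
have -> : 4 * (2 * qb + pb) ^+ 2 / c ^+ 2 * e * (c * M * (c * M / 2)) =
    e * (((2 * qb + pb) * (M * 2)) * ((2 * qb + pb) * M)).
  by field; rewrite gt_eqF.
rewrite ler_wpM2l// normrM ler_pM//; apply: (le_trans Gw).
by rewrite ler_wpM2l ?addr_ge0 ?mulr_ge0// ler_wpM2l// ltW.
Qed.

(* A jump from [i] to [j] changes [m u / m h] by [(w j - w i) / (n D_ i j)], where
   [w = u - (m u / m h) h] has zero mean and size [O(d)]; replacing [D_ i j] by
   [m h] makes the drift of this ratio that of the Euler scheme, up to [O(d / n)]. *)
Lemma particle_step :
  (m u / m h - k) ^+ 2 + e * J (fun i j => (x i j - k) ^+ 2 - (m u / m h - k) ^+ 2) <=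
  (m (K e u) / m (K e h) - k) ^+ 2 + e * particle_error.
Proof.
rewrite euler_ratio -/x0.
suff H : J (fun i j => (x i j - k) ^+ 2 - (x0 - k) ^+ 2) <=
    2 * (x0 - k) * drift + particle_error.
  have := ler_wpM2l e0 H; have := sqr_ge0 (e * drift); lra.
(* Empty sites do not contribute to [J], but its additivity asks for bounds at all sites, and
   [D_ i j] is controlled only for occupied [i]. *)
pose z' i j := if mu i == 0 then 0 else z i j.
pose s := 2 * (x0 - k) / (n * m h).
pose zB := 16 * d / (n ^+ 2 * c ^+ 2).
have zB0 : 0 <= zB.
  by rewrite divr_ge0 ?mulr_ge0 ?exprn_ge0 ?(ltW n0) ?(ltW c0).
have z'B i j : `|z' i j| <= zB.
  by rewrite /z'; case: eqP => [_|/eqP mui]; [rewrite normr0|exact: zle].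
have wB i j : `|w j - w i| <= M * d + M * d by rewrite (le_trans (ler_normB _ _))// lerD.
rewrite (@eq_particle_generator _ (fun i j => s * (w j - w i) + z' i j)); last first.
  by move=> i j mui; rewrite /z' (negbTE mui) /z -/s; ring.
have sB i j : `|s * (w j - w i)| <= `|s| * (M * d + M * d).
  by rewrite normrM ler_wpM2l.
rewrite (particle_generatorD sB z'B) (particle_generatorZ s wB).
rewrite (particle_generator_linear bw mw).
have JZ : J z' <= 16 * (qb + 2 * pb) / c ^+ 2 * d / n.
  apply: (le_trans (ler_norm _)).
  apply: (le_trans (particle_generator_norm zB0 (fun i j _ => z'B i j))).
  by rewrite le_eqVlt; apply/orP; left; apply/eqP; rewrite /zB; field; rewrite !gt_eqF.
pose v := m (fun j => p0 j * w j).
have vle : `|v| <= pb * (M * d).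
  by apply: mean_norm => j; rewrite normrM ler_pM// ger0_norm// (killing_le Hq).
have t1 : 2 * (x0 - k) * (m (G w) / m h - drift) <=
    16 * (2 * qb + pb) ^+ 2 / c ^+ 2 * e.
  apply: (le_trans (ler_norm _)); rewrite normrM.
  have -> : 16 * (2 * qb + pb) ^+ 2 / c ^+ 2 * e =
    2 * 2 * (4 * (2 * qb + pb) ^+ 2 / c ^+ 2 * e) by ring.
  by rewrite ler_pM// normrM ler_pM// ger0_norm.
have t2 : - (2 * (x0 - k) * (v / ((n - 1) * m h))) <= 8 * pb / c * d / n.
  apply: (le_trans (ler_norm _)); rewrite normrN normrM.
  have -> : 8 * pb / c * d / n = 2 * 2 * (pb * (M * d) / (n / 2 * (c * M))).
    by field; rewrite !gt_eqF.
  rewrite ler_pM//; first by rewrite normrM ler_pM// ger0_norm.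
  rewrite normrM ler_pM// normfV gtr0_norm ?mulr_gt0// lef_pV2 ?posrE ?mulr_gt0//.
    by rewrite ler_pM ?divr_ge0 ?(ltW n0) ?(ltW cM0)//; move: n2; lra.
have -> : s * (n * m (G w) - n / (n - 1) * m (fun j => p0 j * w j)) =
   2 * (x0 - k) * drift + 2 * (x0 - k) * (m (G w) / m h - drift) -
   (2 * (x0 - k) * (v / ((n - 1) * m h))).
  by rewrite /s -/v; field; rewrite !gt_eqF.
rewrite /particle_error; move: JZ t1 t2; lra.
Qed.

End particle_step.

(** * Rates and configurations *)

Section offdiagonal_rates.
Variables (R : realType) (F : countType).
Implicit Types (Q : F -> F -> R).

(** The diagonal of [Q] is arbitrary. Setting it to [0] makes the rows finite measures and leaves
    the generators unchanged, as [f j - f i] vanishes there. *)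
Definition offdiag Q (i j : F) : R := if j == i then 0 else Q i j.

Lemma offdiag_ge0 Q i j : rate_matrix Q -> 0 <= offdiag Q i j.
Proof.
by move=> [Q0 _]; rewrite /offdiag; case: eqVneq => // ji; rewrite Q0// eq_sym.
Qed.

Lemma esum_offdiag Q i :
  (\esum_(j in [set: F]) (offdiag Q i j)%:E = exit_rate Q i)%E.
Proof.
rewrite /exit_rate [RHS]esum_mkcond; apply: eq_esum => j _.
have -> : (j \in [set j | j != i]) = (j != i) by apply/idP/idP => [/set_mem|/mem_set].
by rewrite /offdiag; case: eqVneq.
Qed.

Lemma offdiag_weight Q i : rate_matrix Q -> summable_weight (offdiag Q i).
Proof.
move=> rQ; split => [j|]; first exact: offdiag_ge0.
rewrite /absolutely_summable; under eq_esum do rewrite ger0_norm ?offdiag_ge0//.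
by rewrite esum_offdiag; exact: rQ.2.
Qed.

Lemma rsum_offdiag Q i : rate_matrix Q -> ((rsum (offdiag Q i))%:E = exit_rate Q i)%E.
Proof.
by move=> rQ; have [? ?] := offdiag_weight i rQ; rewrite ge0_rsum_EFin// esum_offdiag.
Qed.

Lemma rate_generatorE Q (f : F -> R) i :
  rsum (fun j => Q i j * (f j - f i)) = rsum (fun j => offdiag Q i j * (f j - f i)).
Proof.
by apply: eq_rsum => j; rewrite /offdiag; case: eqP => [->|//]; rewrite subrr !mulr0.
Qed.

Lemma coalescing_rates_offdiag Q (p0 : F -> R) (i0 : F) : rate_matrix Q ->
  (forall i, 0 <= p0 i) ->
  (0 < lambda Q - (sup_rate p0 - inf_rate p0))%E ->
  (ereal_sup (range (exit_rate Q)) < +oo)%E -> (sup_rate p0 < +oo)%E ->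
  exists qb pb l D, coalescing_rates (offdiag Q) p0 qb pb l D.
Proof.
move=> rQ p00 rho_gt0 Q_bounded p0_bounded.
have wq i := offdiag_weight i rQ.
have supP i : ((p0 i)%:E <= sup_rate p0)%E by apply: ereal_sup_ubound; exists i.
have infP i : (inf_rate p0 <= (p0 i)%:E)%E by apply: ereal_inf_lbound; exists i.
have inf0 : (0 <= inf_rate p0)%E.
  by apply: le_ereal_inf_tmp => _ [i _ <-]; rewrite lee_fin.
have sup_fin : sup_rate p0 \is a fin_num.
  by rewrite ge0_fin_numE// (le_trans _ (supP i0))// lee_fin.
have inf_fin : inf_rate p0 \is a fin_num.
  by rewrite ge0_fin_numE// (le_lt_trans (infP i0))// ltry.
have exP i : (exit_rate Q i <= ereal_sup (range (exit_rate Q)))%E.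
  by apply: ereal_sup_ubound; exists i.
have ex_fin : ereal_sup (range (exit_rate Q)) \is a fin_num.
  rewrite ge0_fin_numE// (le_trans _ (exP i0))// -esum_offdiag esum_ge0// => j _.
  by rewrite lee_fin offdiag_ge0.
pose D := fine (sup_rate p0) - fine (inf_rate p0).
have DE : (sup_rate p0 - inf_rate p0 = D%:E)%E by rewrite /D EFinB !fineK.
have Dl : (D%:E < lambda Q)%E by move: rho_gt0; rewrite DE sube_gt0.
(* [lambda] itself when it is finite; with [+oo], any real above [D] will do. *)
have [l Dltl llam] : exists2 l, D < l & (l%:E <= lambda Q)%E.
  move: Dl; case: (lambda Q) => [l| |//].
    by rewrite lte_fin => Dl; exists l.
  by move=> _; exists (D + 1); rewrite ?ltrDl// leey.
exists (fine (ereal_sup (range (exit_rate Q)))), (fine (sup_rate p0)), l, D; split.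
- exact: wq.
- by move=> i; rewrite -lee_fin rsum_offdiag// fineK.
- exact: p00.
- by move=> i; rewrite -lee_fin fineK.
- by move=> i i'; rewrite /D lerB// -lee_fin fineK.
- move=> i i' ii'; rewrite -lee_fin; apply: (le_trans llam).
  have o0 j : 0 <= overlap (offdiag Q) i i' j.
    by rewrite /overlap; case: ifP => // _; rewrite le_min !offdiag_ge0.
  rewrite EFinD ge0_rsum_EFin//; last first.
    apply: summ_le (wq i).2 => j; rewrite ger0_norm// /overlap.
    by case: ifP => _; rewrite ?offdiag_ge0// ge_min lexx.
  apply: ereal_inf_lbound; exists (i, i') => //=; congr (_ + _)%E.
    by rewrite /offdiag [i' == i]eq_sym (negbTE ii').
  rewrite esum_mkcond; apply: eq_esum => j _.
  have -> : (j \in [set j | j != i /\ j != i']) = (j != i) && (j != i').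
    by apply/idP/andP => [/set_mem[]|[? ?]]; [split|apply/mem_set].
  rewrite /overlap /offdiag; case: (eqVneq j i) => //= _.
  by case: (eqVneq j i').
- by rewrite /D subr_ge0 fine_le// (le_trans (infP i0) (supP i0)).
- by [].
Qed.

End offdiagonal_rates.

Section configurations.
Variables (R : realType) (F : countType) (N : nat).
Hypothesis N2 : (2 <= N)%N.
Implicit Types (eta : config F N) (i j k : F).

Local Notation n := (N%:R : R).

Let N0 : 0 < n. Proof. by rewrite ltr0n (leq_trans _ N2). Qed.

Lemma esum_occ eta : (\esum_(i in [set: F]) ((occ eta i)%:R)%:E = n%:E)%E.
Proof.
have -> : (\esum_(i in [set: F]) ((occ eta i)%:R)%:E =
    \esum_(i in [set` finsupp (val eta)]) ((occ eta i)%:R : R)%:E)%E.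
  rewrite [RHS]esum_mkcond; apply: eq_esum => i _; case: ifPn => //.
  by rewrite notin_setE /= => /negP ni; rewrite /occ memNfinsupp in ni *; rewrite (eqP ni).
rewrite esum_fset//.
rewrite fsbig_finite//= set_fsetK sumEFin -natr_sum.
by rewrite (eqP (valP eta)).
Qed.

Lemma occ_weight eta : summable_weight (fun i => (occ eta i)%:R : R).
Proof.
split => [i|]; first by [].
by rewrite /absolutely_summable; under eq_esum do rewrite ger0_norm//; rewrite esum_occ ltry.
Qed.

Lemma rsum_occ eta : rsum (fun i => (occ eta i)%:R) = n.
Proof.
have [? ?] := occ_weight eta.
by rewrite ge0_rsumE// esum_occ.
Qed.

Lemma empirical_weight eta : summable_weight (empirical R eta).
Proof.
have [? ?] := occ_weight eta.
by split => [i|]; [rewrite mulr_ge0// invr_ge0 ltW|exact: summZ].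
Qed.

Lemma rsum_empirical eta : rsum (empirical R eta) = 1.
Proof.
have [? ?] := occ_weight eta.
by rewrite /empirical rsumZ// rsum_occ mulVf// gt_eqF.
Qed.

Lemma empiricalK eta i : n * empirical R eta i = (occ eta i)%:R.
Proof. by rewrite /empirical mulrA divff ?mul1r// gt_eqF. Qed.

Lemma meanE (mu f : F -> R) : mean mu f = rsum (fun j => mu j * f j).
Proof. by apply: eq_rsum => j; rewrite mulrC. Qed.

Lemma occ_move eta i j k : occ eta i != 0%N ->
  ((occ (move i j eta) k)%:R : R) = (occ eta k)%:R - (k == i)%:R + (k == j)%:R.
Proof.
move=> ei; rewrite {1}/occ (val_move j ei) /move_fsfun !fsfun_withE.
have e1 : (((occ eta i).-1)%:R : R) = (occ eta i)%:R - 1.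
  by rewrite -subn1 natrB// lt0n.
case: (eqVneq k j) => [->|kj].
  rewrite -natr1; case: (eqVneq j i) => [->|ji] /=; last by rewrite subr0.
  by rewrite -[(val eta) i]/(occ eta i) e1.
rewrite addr0; case: (eqVneq k i) => [->|ki]; last by rewrite subr0.
by rewrite -[(val eta) i]/(occ eta i) e1.
Qed.

Lemma move_diag eta i : occ eta i != 0%N -> move i i eta = eta.
Proof.
move=> ei; apply: val_inj; apply/fsfunP => k.
by have := occ_move i k ei; rewrite addrNK => /eqP; rewrite eqr_nat => /eqP.
Qed.

Lemma mean_move eta i j (f : F -> R) : bounded f -> occ eta i != 0%N ->
  rsum (fun k => empirical R (move i j eta) k * f k) =
  rsum (fun k => empirical R eta k * f k) + (f j - f i) / n.
Proof.
move=> bf ei; rewrite (@eq_rsum _ _ _ (fun k => empirical R eta k * f k +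
   n^-1 * ((k == j)%:R * f k - (k == i)%:R * f k))).
  rewrite rsumD; [|exact/wsumm/bf/empirical_weight|].
    rewrite rsumZ; last by apply: summB; exact: summ_delta.
    by rewrite rsumB ?rsum_delta 1?mulrC//; exact: summ_delta.
  by apply: summZ; apply: summB; exact: summ_delta.
by move=> k; rewrite /empirical occ_move//; ring.
Qed.

(** Moves from an empty site carry weight [0], and the move from [i] to [i] is the identity, which
    removes the diagonal of [Q]. *)
Lemma fv_generatorE (Q : F -> F -> R) p0 (V : config F N -> R) eta :
  fv_generator Q p0 V eta =
  particle_generator (offdiag Q) p0 n (empirical R eta)
    (fun i j => V (move i j eta) - V eta).
Proof.
apply: eq_rsum => i; rewrite empiricalK.
have [->|ei] := eqVneq (occ eta i) 0%N; first by rewrite !mul0r.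
congr (_ * _); apply: eq_rsum => j; rewrite /particle_rate empiricalK /offdiag.
have -> : ((N.-1)%:R : R) = n - 1 by rewrite -subn1 natrB// ltnW.
case: (eqVneq j i) => [->|_]; first by rewrite move_diag// subrr mul0r mulr0.
by rewrite mulrC.
Qed.

Lemma empirical_neq0 eta i : empirical R eta i != 0 -> occ eta i != 0%N.
Proof. by apply: contra_neq => ei; rewrite /empirical ei mulr0. Qed.

End configurations.

(** * Convergence of the Euler scheme *)

Section killed_semigroup.
Variables (R : realType) (F : countType).
Variables (Q : F -> F -> R) (p0 : F -> R) (qb pb l D : R).
Hypothesis Hq : coalescing_rates (offdiag Q) p0 qb pb l D.
Variable p : R -> option F -> option F -> R.
Hypothesis pK : transition_function_of (killed_generator Q p0) p.

Let tp : transition_function p := pK.1.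
Let gp : has_generator p (killed_generator Q p0) := pK.2.
Local Notation P := (semigroup p).
Local Notation K := (euler (offdiag Q) p0).
Local Notation C := (`|qb| + `|pb|).

Let C0 : 0 <= C. Proof. by rewrite addr_ge0. Qed.

(** The exit rates are at most [qb + pb]; the absolute values in [C] give its sign without
    exhibiting a site. *)
Lemma killed_generator_diag_ge x : - C <= killed_generator Q p0 (fun y => (y == x)%:R) x.
Proof.
case: x => [i|] /=; last by rewrite oppr_le0.
have := rate_generatorE Q (fun j => (Some j == Some i)%:R : R) i; rewrite /= => ->.
rewrite sub0r eqxx mulrN1 opprD addrC lerD//.
  by rewrite lerN2 (le_trans (killing_le Hq i))// ler_norm.
have H : `|rsum (fun j => offdiag Q i j * ((Some j == Some i)%:R - (Some i == Some i)%:R))|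
    <= 1 * rsum (offdiag Q i).
  rewrite eqxx; apply: (wsum_norm (rates_weight Hq i)) => j _.
  by case: eqP; rewrite ?subrr ?sub0r ?normr0 ?normrN ?normr1.
rewrite eqxx in H; rewrite lerNl (le_trans (ler_norm _))// normrN.
by apply: (le_trans H); rewrite mul1r (le_trans (rates_total Hq i))// ler_norm.
Qed.

Lemma extend0_norm (f : F -> R) (M : R) : 0 <= M -> (forall i, `|f i| <= M) ->
  forall x, `|extend0 f x| <= M.
Proof. by move=> M0 fM [i|] //=; rewrite normr0. Qed.

Lemma extend0_euler e (f : F -> R) x :
  extend0 (K e f) x = extend0 f x + e * killed_generator Q p0 (extend0 f) x.
Proof.
case: x => [i|] /=; last by rewrite mulr0 addr0.
by rewrite /euler /killed (rate_generatorE Q f i); ring.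
Qed.

(** The one-step errors add up without amplification, because the semigroup contracts the supremum
    norm and the Euler operator preserves the bound [M]. *)
Lemma killed_semigroup_euler e j (f : F -> R) (M : R) x : 0 <= e ->
  e * (2 * qb + pb + l) <= 1 -> 0 <= M -> (forall i, `|f i| <= M) ->
  `|P (j%:R * e) (extend0 f) x - extend0 (iter j (K e) f) x| <=
  j%:R * (4 * C ^+ 2 * M * e ^+ 2).
Proof.
move=> e0 he M0; elim: j f x => [|j ih] f x fM.
  have := semigroup_sub_id tp gp C0 killed_generator_diag_ge x (lexx 0) (extend0_norm M0 fM).
  by rewrite !mul0r mulr0.
have je0 : 0 <= j%:R * e by rewrite mulr_ge0.
have bf : bounded (extend0 f) by exists M; exact: extend0_norm.
have bK : bounded (extend0 (K e f)).
  by exists M; apply: extend0_norm => //; exact: (euler_norm Hq).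
rewrite -natr1 [(_ + 1) * e]mulrDl [(_ + 1) * (_ * _)]mulrDl !mul1r semigroupD//.
have -> : iter j.+1 (K e) f = iter j (K e) (K e f) by rewrite iterSr.
have bPe := semigroup_bounded tp e0 bf.
have -> : P (j%:R * e) (P e (extend0 f)) x - extend0 (iter j (K e) (K e f)) x =
  (P (j%:R * e) (extend0 (K e f)) x - extend0 (iter j (K e) (K e f)) x) +
  P (j%:R * e) (fun y => P e (extend0 f) y - extend0 (K e f) y) x.
  by rewrite (semigroupB tp)//; ring.
rewrite (le_trans (ler_normD _ _))// lerD//.
  by apply: ih; exact: (euler_norm Hq).
apply: (semigroup_norm tp) => // y; rewrite extend0_euler.
by apply: (semigroup_euler tp gp C0 killed_generator_diag_ge) => //; exact: extend0_norm.
Qed.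

Lemma indic_extend0 : \1_(~` [set None]) = extend0 (fun _ : F => 1 : R).
Proof.
apply/funext => -[i|] /=; rewrite indicE.
  by rewrite mem_set//= .
by rewrite memNset//=; apply.
Qed.

Variables (mu : F -> R).
Hypothesis wmu : summable_weight mu.
Hypothesis mu1 : rsum mu = 1.
Variable t : R.
Hypothesis t0 : 0 <= t.
Local Notation m f := (rsum (fun j => mu j * f j)).

Definition euler_iter J (f : F -> R) := iter J.+1 (K (t / J.+1%:R)) f.

Lemma time_step_cvg (k : R) : k * (t / J.+1%:R) @[J --> \oo] --> (0 : R).
Proof.
rewrite -[X in _ --> X](mulr0 (k * t)).
under eq_fun do rewrite mulrA.
by apply: cvgMr; exact: cvg_harmonic.
Qed.

Lemma mean_euler_cvg (f : F -> R) : (forall i, `|f i| <= 1) ->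
  m (euler_iter J f) @[J --> \oo] --> m (fun y => P t (extend0 f) (Some y)).
Proof.
move=> f1; apply/cvgrPdist_le => eps eps0.
have c1 := time_step_cvg (2 * qb + pb + l).
have c2 := time_step_cvg (4 * C ^+ 2 * t).
move/cvgrPdist_le/(_ 1 ltr01): c1 => c1.
move/cvgrPdist_le/(_ eps eps0): c2 => c2.
near=> J.
have h1 : t / J.+1%:R * (2 * qb + pb + l) <= 1.
  rewrite mulrC; apply: le_trans (ler_norm _) _; rewrite -normrN -sub0r.
  by near: J.
have h2 : 4 * C ^+ 2 * t * (t / J.+1%:R) <= eps.
  apply: le_trans (ler_norm _) _; rewrite -normrN -sub0r.
  by near: J.
have e0 : 0 <= t / J.+1%:R by rewrite divr_ge0.
have Jt : t = J.+1%:R * (t / J.+1%:R) by rewrite mulrC divfK.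
have bf : bounded (euler_iter J f).
  by apply: (iter_euler_bounded Hq); exists 1.
have bP : bounded (fun y => P t (extend0 f) (Some y)).
  exists 1 => y; apply: (semigroup_norm tp) => //; exact: extend0_norm.
rewrite -(wsumB wmu)//; apply: (mean_norm wmu mu1) => y.
apply: le_trans h2; rewrite {1}Jt.
have := killed_semigroup_euler J.+1 (Some y) e0 h1 ler01 f1.
rewrite [extend0 _ (Some y)]/= => /le_trans; apply.
rewrite le_eqVlt; apply/orP; left; apply/eqP.
by field.
Unshelve. all: by end_near. Qed.

(** Being at the starting site at time [t] implies survival. The lower bound on this probability
    does not depend on the site, so it passes to the mean; [J] is chosen to make [C * (t / J)] less
    than [1]. *)
Lemma killed_survival_gt0 : 0 < m (fun y => P t (extend0 (fun=> 1)) (Some y)).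
Proof.
pose J := (Num.truncn (C * t)).+1.
have J0 : 0 < J%:R :> R by rewrite ltr0n.
have CJ : C * (t / J%:R) < 1.
  by rewrite mulrA ltr_pdivrMr// mul1r; exact: truncnS_gt.
have tJ0 : 0 <= t / J%:R by rewrite divr_ge0.
have e1 : forall i : F, `|1 : R| <= 1 by move=> _; rewrite normr1.
have bext : bounded (extend0 (fun _ : F => 1 : R)) by exists 1; exact: extend0_norm.
apply: (@lt_le_trans _ _ ((1 - C * (t / J%:R)) ^+ J)).
  by rewrite exprn_gt0// subr_gt0.
apply: (mean_ge wmu mu1).
  by exists 1 => y; apply: (semigroup_norm tp) => //; exact: extend0_norm.
move=> y; apply: (@le_trans _ _ (p t (Some y) (Some y))).
  have := transition_diag_pow tp (Some y) J tJ0.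
  rewrite [J%:R * _]mulrC divfK ?gt_eqF//; apply: le_trans.
  have := transition_diag_ge tp gp C0 killed_generator_diag_ge (Some y) tJ0.
  move=> H; apply: lerXn2r => //; rewrite ?nnegrE ?subr_ge0 ?(ltW CJ)//.
  exact: transition_ge0.
rewrite -(semigroup_delta p t (Some y)); apply: ler_semigroup => //.
by move=> [z|] //=; case: eqP.
Qed.

Lemma conditionedE (phi : F -> R) : conditioned p mu t phi =
  m (fun y => P t (extend0 phi) (Some y)) / m (fun y => P t (extend0 (fun=> 1)) (Some y)).
Proof.
by rewrite /conditioned indic_extend0; congr (_ / _); apply: eq_rsum => y; rewrite mulrC.
Qed.

Lemma conditioned_cvg (phi : F -> R) : (forall i, `|phi i| <= 1) ->
  m (euler_iter J phi) / m (euler_iter J (fun=> 1)) @[J --> \oo] -->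
  conditioned p mu t phi.
Proof.
move=> phi1; rewrite conditionedE; apply: cvgM; first exact: mean_euler_cvg.
apply: cvgV; first by rewrite gt_eqF// killed_survival_gt0.
by apply: mean_euler_cvg => i; rewrite normr1.
Qed.

Lemma conditioned_norm (phi : F -> R) : (forall i, `|phi i| <= 1) ->
  `|conditioned p mu t phi| <= 1.
Proof.
move=> phi1; rewrite conditionedE; apply: (mean_ratio_le1 wmu).
- exists 1 => y; apply: (semigroup_norm tp) => //; apply: extend0_norm => // j.
  by rewrite normr1.
- have b1 : bounded (extend0 (fun _ : F => 1 : R)).
    by exists 1; apply: extend0_norm => // j; rewrite normr1.
  have bphi : bounded (extend0 phi) by exists 1; apply: extend0_norm.
  have H z : - extend0 (fun=> 1) z <= extend0 phi z <= extend0 (fun=> 1) z.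
    by rewrite -ler_norml; case: z => [z|] /=; rewrite ?normr0.
  move=> y; rewrite ler_norml; apply/andP; split; last first.
    by apply: (ler_semigroup tp) => // z; case/andP: (H z).
  rewrite -mulN1r -(semigroupZ tp)//; apply: (ler_semigroup tp) => //.
    exact: boundedZ.
  by move=> z; rewrite mulN1r; case/andP: (H z).
- exact: killed_survival_gt0.
Qed.

End killed_semigroup.

(** * Uniform bound for the Fleming-Viot process *)

Section fleming_viot_semigroup.
Variables (R : realType) (F : countType).
Variables (Q : F -> F -> R) (p0 : F -> R) (qb pb l D : R).
Hypothesis Hq : coalescing_rates (offdiag Q) p0 qb pb l D.
Variable N : nat.
Hypothesis N2 : (2 <= N)%N.
Variable p : R -> config F N -> config F N -> R.
Hypothesis pFV : transition_function_of (@fv_generator R F Q p0 N) p.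

Let tp : transition_function p := pFV.1.
Let gp : has_generator p (@fv_generator R F Q p0 N) := pFV.2.
Local Notation P := (semigroup p).
Local Notation K := (euler (offdiag Q) p0).
Local Notation n := (N%:R : R).
Local Notation c := (ratio_bound l D).
Local Notation C := ((`|qb| + 2 * `|pb|) * n).
Local Notation m eta f := (rsum (fun j => empirical R eta j * f j)).

Implicit Types eta : config F N.

Let n2 : 2 <= n. Proof. by rewrite ler_nat. Qed.
Let n0 : 0 < n. Proof. exact: lt_le_trans n2. Qed.
Let C0 : 0 <= C. Proof. by rewrite mulr_ge0// addr_ge0// mulr_ge0. Qed.
Let wmu eta := @empirical_weight R F N eta.
Let mu1 eta := @rsum_empirical R F N N2 eta.

(** The total jump rate of [N] particles is of order [N], hence so is [C]; it enters only terms in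
    [e^2] below. *)
Lemma fv_generator_diag_ge eta :
  - C <= fv_generator Q p0 (fun y => (y == eta)%:R) eta.
Proof.
rewrite fv_generatorE//.
have H : `|particle_generator (offdiag Q) p0 n (empirical R eta)
    (fun i j => (move i j eta == eta)%:R - (eta == eta)%:R)| <= (qb + 2 * pb) * 1 * n.
  apply: (particle_generator_norm Hq n2 (wmu eta) (mu1 eta)) => // i j _.
  by rewrite eqxx; case: eqP; rewrite ?subrr ?sub0r ?normr0 ?normrN ?normr1.
rewrite lerNl (le_trans (ler_norm _))// normrN (le_trans H)// mulr1.
by rewrite ler_wpM2r ?(ltW n0)// lerD ?ler_norm// ler_wpM2l// ler_norm.
Qed.

Variables (e k : R) (phi : F -> R).
Hypothesis e0 : 0 <= e.
Hypothesis he : e * (2 * qb + pb + l) <= 1.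
Hypothesis epb : e * pb <= 1 / 2.
Hypothesis phi1 : forall i, `|phi i| <= 1.
Hypothesis k1 : `|k| <= 1.

Let H j := iter j (K e) (fun=> 1).
Let U j := iter j (K e) phi.

(* [V j x] is the squared error at a time [j * e] before the final time, when the
   remaining evolution of the configuration [x] is the deterministic one. *)
Definition square_error j (eta : config F N) : R := (m eta (U j) / m eta (H j) - k) ^+ 2.
Local Notation V := square_error.

Let comparable_H j : comparable_values l D (H j).
Proof. exact: (iter_euler_comparable Hq e0 he). Qed.

Let mH0 eta j : 0 < m eta (H j).
Proof.
have [i _] : exists i, empirical R eta i != 0 by exact: (rsum_eq1_neq0 (mu1 eta)).
have [M M0 hM] := comparable_sup Hq i (comparable_H j).
have cM0 : 0 < c * M by rewrite mulr_gt0// (ratio_bound_gt0 Hq).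
apply: (lt_le_trans cM0); apply: (mean_ge (wmu eta) (mu1 eta)).
  exact: comparable_bounded (comparable_H j).
by move=> a; case/andP: (hM a).
Qed.

Let V_norm j eta : `|V j eta| <= 4.
Proof.
rewrite ger0_norm ?sqr_ge0// /V -(real_normK (num_real _)).
have -> : 4 = 2 ^+ 2 :> R by rewrite expr2 -natrM.
rewrite lerXn2r ?nnegrE// (le_trans (ler_normB _ _))// (natrD _ 1 1) lerD//.
apply: (mean_ratio_le1 (wmu eta)) => //.
  exact: comparable_bounded (comparable_H j).
exact: (iter_euler_norm Hq e0 he phi1).
Qed.

Definition linear_constant : R := 16 * (qb + 2 * pb) / c ^+ 2 + 8 * pb / c.
Definition quadratic_constant : R :=
  16 * (2 * qb + pb) ^+ 2 / c ^+ 2 + 16 * C ^+ 2.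

(** Up to [O(e^2)], [P e] is one Euler step of the particle generator, and [particle_step] trades it
    for one deterministic step, with [d] the oscillation left after [j] steps. The term [16 C^2] of
    [quadratic_constant] is the error of [semigroup_euler] for a function bounded by [4]. *)
Lemma square_error_step j eta : P e (V j) eta <= V j.+1 eta +
  (linear_constant / n * (e * (2 * (1 - e * (c * l)) ^+ j)) + e ^+ 2 * quadratic_constant).
Proof.
have [i0 _] : exists i, empirical R eta i != 0 by exact: (rsum_eq1_neq0 (mu1 eta)).
have [M M0 hM] := comparable_sup Hq i0 (comparable_H j).
have := semigroup_euler tp gp C0 fv_generator_diag_ge eta e0 (V_norm j).
have bH := comparable_bounded (comparable_H j).
have bU : bounded (U j) by apply: (iter_euler_bounded Hq); exists 1.
pose d := 2 * (1 - e * (c * l)) ^+ j.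
have ctr0 := contraction_ge0 Hq e0 he i0.
have cl0 : 0 <= e * (c * l).
  rewrite mulr_ge0// mulr_ge0 ?(ltW (ratio_bound_gt0 Hq))//.
  exact: ltW (le_lt_trans (osc_ge0 Hq) (osc_lt Hq)).
have d0 : 0 <= d by rewrite mulr_ge0// exprn_ge0.
have d2 : d <= 2.
  by rewrite /d ler_piMr// exprn_ile1// lerBlDr lerDl.
(* The right-hand side is the mean of [H j] over the configuration after the jump. *)
have DM a b : empirical R eta a != 0 -> c * M <= m eta (H j) + (H j b - H j a) / n.
  move=> /empirical_neq0 ea; rewrite -(mean_move b bH ea).
  by apply: (mean_ge (wmu _) (mu1 _)) => // z; case/andP: (hM z).
have := particle_step Hq n2 (wmu eta) (mu1 eta) e0 he epb M0 hM
  (iter_euler_norm Hq e0 he phi1 j) d0 d2 (iter_euler_ratio_osc Hq e0 he phi1 j) k1 DM.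
rewrite fv_generatorE// (@eq_particle_generator _ _ _ _ n (empirical R eta)
  (fun a b => V j (move a b eta) - V j eta) (fun a b =>
   ((m eta (U j) + (U j b - U j a) / n) / (m eta (H j) + (H j b - H j a) / n) - k) ^+ 2
   - (m eta (U j) / m eta (H j) - k) ^+ 2)); last first.
  move=> a b /empirical_neq0 ea; rewrite /V.
  by rewrite (mean_move b bH ea) (mean_move b bU ea).
rewrite -/(V j eta) -[(m eta (K e (iter j (K e) phi)) / _ - k) ^+ 2]/(V j.+1 eta).
rewrite /particle_error -/linear_constant -/d.
move=> step; rewrite ler_norml => /andP[_ euler_le].
have -> : linear_constant / n * (e * d) + e ^+ 2 * quadratic_constant =
  e * (linear_constant * d / n + 16 * (2 * qb + pb) ^+ 2 / c ^+ 2 * e) +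
   4 * C ^+ 2 * 4 * e ^+ 2 by rewrite /quadratic_constant; ring.
by move: step euler_le; lra.
Qed.

(** The errors linear in [e] form a geometric series of ratio [1 - e * (c * l)], whose sum is
    bounded whatever the number of steps: this is the uniformity in time. *)
Lemma square_error_iter j eta : 0 < l -> P (j%:R * e) (V 0) eta <= V j eta +
  (linear_constant / n * (2 / (c * l)) * (1 - (1 - e * (c * l)) ^+ j) +
   j%:R * (e ^+ 2 * quadratic_constant)).
Proof.
move=> l0; have cl0 : 0 < c * l by rewrite mulr_gt0// (ratio_bound_gt0 Hq).
elim: j eta => [|j ih] eta.
  have := semigroup_sub_id tp gp C0 fv_generator_diag_ge eta (lexx 0) (V_norm 0).
  rewrite !mul0r mulr0 expr0 subrr mulr0 !addr0 ler_norml => /andP[_]; lra.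
have je0 : 0 <= j%:R * e by rewrite mulr_ge0.
have bV i : bounded (V i) by exists 4 => x; exact: V_norm.
(* The new step is put outermost, so that the induction hypothesis, valid at every configuration,
   applies under [P e]. *)
rewrite -natr1 mulrDl mul1r addrC semigroupD//.
pose a := linear_constant / n * (2 / (c * l)) * (1 - (1 - e * (c * l)) ^+ j) +
   j%:R * (e ^+ 2 * quadratic_constant).
have := ler_semigroup tp eta e0 (semigroup_bounded tp je0 (bV 0))
  (boundedD (bV j) (@bounded_cst R (config F N) a)) ih.
move=> /le_trans; apply.
rewrite (_ : (fun x => V j x + a) = (fun x => V j x - - a)); last first.
  by apply/funext => x; rewrite opprK.
rewrite semigroupB// semigroup_cst// opprK.
apply: le_trans (lerD (square_error_step j eta) (lexx a)) _.
have -> : linear_constant / n * (e * (2 * (1 - e * (c * l)) ^+ j)) =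
  linear_constant / n * (2 / (c * l)) * (e * (c * l) * (1 - e * (c * l)) ^+ j).
  by field; rewrite !gt_eqF// (ratio_bound_gt0 Hq).
by rewrite /a [_ ^+ j.+1]exprSr le_eqVlt; apply/orP; left; apply/eqP; ring.
Qed.

End fleming_viot_semigroup.

(** * Laws and expectations of processes with countably many states *)

Section discrete_random_variable.
Context (d : measure_display) (W : measurableType d) (R : realType).
Context (P : probability W R) (S : countType) (X : W -> S).
Hypothesis mX : forall x, measurable [set w | X w = x].

(** No sigma-algebra is put on [S]: a preimage is a countable union of fibres of [X], enumerated by
    [pickle]. *)
Lemma measurable_fun_discrete (g : S -> \bar R) :
  measurable_fun [set: W] (g \o X : W -> \bar R).
Proof.
move=> _ B _; rewrite setTI.
rewrite (_ : _ @^-1` B = \bigcup_n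
  (if choice.unpickle n is Some x then [set w | X w = x /\ B (g x)] else set0)).
  apply: bigcup_measurable => n _; case: (choice.unpickle n) => // x.
  have [Bx|nBx] := pselect (B (g x)).
    by rewrite (_ : mkset _ = [set w | X w = x])//; apply/seteqP; split => w /=; tauto.
  by rewrite (_ : mkset _ = set0)//; apply/seteqP; split => w /=; tauto.
apply/seteqP; split => [w Bw|w [n _]] /=.
  by exists (choice.pickle (X w)) => //; rewrite choice.pickleK.
by case: (choice.unpickle n) => //= x [->].
Qed.

(** The space is partitioned along the codes of the values, so that countable additivity is used
    over the natural numbers; numbers that code nothing give empty pieces. *)
Lemma integral_discrete (g : S -> R) : (forall x, 0 <= g x) ->
  (\int[P]_w (g (X w))%:E =
   \esum_(x in [set: S]) ((g x)%:E * P [set w | X w = x]))%E.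
Proof.
move=> g0; pose E n := [set w | choice.pickle (X w) = n].
have EE x : E (choice.pickle x) = [set w | X w = x].
  by apply/seteqP; rewrite /E; split => w /=; [exact: (pcan_inj choice.pickleK)|move=> <-].
have E0 n : (forall x : S, choice.pickle x <> n) -> E n = set0.
  by move=> nx; rewrite -subset0 => w /= wn; exact: (nx _ wn).
have mE n : measurable (E n).
  have [[x <-]|/forallNP nx] := pselect (exists x : S, choice.pickle x = n).
    by rewrite EE.
  by rewrite E0.
have UE : [set: W] = \bigcup_n E n.
  by apply/seteqP; split => w // _; exists (choice.pickle (X w)).
rewrite [in LHS]UE ge0_integral_bigcup//=; last 3 first.
- rewrite -UE; exact: (measurable_fun_discrete (EFin \o g)).
- by move=> w _; rewrite lee_fin.
- by apply/trivIsetP => i j _ _ /eqP ij; rewrite -subset0 => w [wi wj]; apply: ij; rewrite -wi -wj.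
rewrite nneseries_esumT; last by move=> n; apply: integral_ge0 => w _; rewrite lee_fin.
have -> : (\esum_(n in [set: nat]) \int[P]_(w in E n) (g (X w))%:E =
    \esum_(n in range (@choice.pickle S)) \int[P]_(w in E n) (g (X w))%:E)%E.
  rewrite [RHS]esum_mkcond; apply: eq_esum => n _; case: ifPn => //.
  rewrite notin_setE /= => nn; rewrite E0 ?integral_set0// => x xn.
  by apply: nn; exists x.
rewrite (@reindex_esum _ _ _ [set: S] _ choice.pickle).
  apply: eq_esum => x _; rewrite EE.
  rewrite (eq_integral (cst (g x)%:E)) ?integral_cst// => w.
  by rewrite inE /= => ->.
by split => // x y _ _; exact: (pcan_inj choice.pickleK).
Qed.

End discrete_random_variable.

Section expectation_markov.
Context (R : realType) (S : countType) (d : measure_display) (W : measurableType d).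
Context (P : probability W R) (p : R -> S -> S -> R) (X : R -> W -> S) (x0 : S).
Hypothesis tp : transition_function p.
Hypothesis mX : markov_process P p X.
Hypothesis X0 : starts_at P X x0.

Lemma markov_process_law t x : 0 <= t -> P [set w | X t w = x] = (p t x0 x)%:E.
Proof.
(* [process_markov] takes infinite sequences of times; only the two times [0] and [t] count here,
   and the event at time [0] has full probability. *)
move=> t0; pose ts n : R := if n is 0%N then 0 else t.
pose xs n := if n is 0%N then x0 else x.
have tsle k : ts k <= ts k.+1 by case: k.
have := @process_markov _ _ _ _ _ _ _ mX 1 ts xs erefl tsle.
rewrite big_ord1 /= subr0 X0 mul1e => <-.
have m0 := process_measurable mX x0 (lexx 0).
have mt := process_measurable mX x t0.
have n0 : P (~` [set w | X 0 w = x0]) = 0%E.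
  by rewrite probability_setC// X0 subee.
have -> : \bigcap_(k in `I_2) [set w | X (ts k) w = xs k] =
    [set w | X t w = x] `\` ~` [set w | X 0 w = x0].
  apply/seteqP; split => [w H|w [Ht H0] [|[|k]]]//=.
    by split; [exact: (H 1%N)|move=> H0; apply: H0; exact: (H 0%N)].
  by move=> _; exact: contrapT.
rewrite measureD//; [|exact: measurableC|by rewrite ltey_eq fin_num_measure].
rewrite [X in (_ - X)%E](_ : _ = 0%E) ?sube0//.
apply/eqP; rewrite eq_le measure_ge0 andbT -n0 le_measure// ?inE.
- by apply: measurableI => //; exact: measurableC.
- exact: measurableC.
Qed.

Lemma expectation_semigroup t (g : S -> R) : 0 <= t -> bounded g ->
  (forall x, 0 <= g x) -> ('E_P[fun w => g (X t w)] = (semigroup p t g x0)%:E)%E.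
Proof.
move=> t0 bg g0; rewrite unlock integral_discrete//; last first.
  by move=> x; exact: (process_measurable mX).
rewrite /semigroup ge0_rsum_EFin.
- by apply: eq_esum => x _; rewrite markov_process_law// -EFinM mulrC.
- by move=> x; rewrite mulr_ge0//; exact: transition_ge0.
- by apply: wsumm => //; exact: (transition_weight tp).
Qed.

End expectation_markov.

(** * Limit of small time steps, and passage from squares to absolute values *)

Section uniform_bound.
Variables (R : realType) (F : countType).
Variables (Q : F -> F -> R) (p0 : F -> R) (qb pb l D : R).
Hypothesis Hq : coalescing_rates (offdiag Q) p0 qb pb l D.
Variable pK : R -> option F -> option F -> R.
Hypothesis hK : transition_function_of (killed_generator Q p0) pK.
Variable N : nat.
Hypothesis N2 : (2 <= N)%N.
Variable p : R -> config F N -> config F N -> R.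
Hypothesis pFV : transition_function_of (@fv_generator R F Q p0 N) p.
Variables (eta : config F N) (t : R) (phi : F -> R).
Hypothesis t0 : 0 <= t.
Hypothesis phi1 : forall i, `|phi i| <= 1.

Local Notation n := (N%:R : R).
Local Notation c := (ratio_bound l D).
Local Notation m eta f := (rsum (fun j => empirical R eta j * f j)).

Definition uniform_constant : R := linear_constant qb pb l D * (2 / (c * l)).

(** [k] is the exact conditioned value, whereas the scheme yields [ratio J]. The initial square
    [(ratio J - k)^2] therefore only tends to [0], together with the [e^2] errors, as [J] grows with
    [N] and [t] fixed. *)
Lemma fleming_viot_square_error :
  semigroup p t (fun x => (m x phi - conditioned pK (empirical R eta) t phi) ^+ 2) eta
  <= uniform_constant / n.
Proof.
have wmu := @empirical_weight R F N eta.
have mu1 := @rsum_empirical R F N N2 eta.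
set k := conditioned _ _ _ _.
have k1 : `|k| <= 1 by exact: (conditioned_norm Hq hK wmu mu1 t0 phi1).
have l0 : 0 < l by exact: le_lt_trans (osc_ge0 Hq) (osc_lt Hq).
have c0 := ratio_bound_gt0 Hq.
have [i0 _] := rsum_eq1_neq0 mu1.
have pb0 : 0 <= pb by exact: le_trans (killing_ge0 Hq i0) (killing_le Hq i0).
have qb0 : 0 <= qb.
  apply: le_trans (rates_total Hq i0); apply: ge0_rsum.
  exact: (rates_weight Hq i0).1.
have n0 : 0 < n by rewrite ltr0n (leq_trans _ N2).
have lc0 : 0 <= linear_constant qb pb l D.
  by rewrite addr_ge0// divr_ge0 ?exprn_ge0 ?(ltW c0)// mulr_ge0// addr_ge0// mulr_ge0.
pose ratio J := m eta (euler_iter Q p0 t J phi) / m eta (euler_iter Q p0 t J (fun=> 1)).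
have ratio_cvg : ratio J @[J --> \oo] --> k by exact: (conditioned_cvg Hq hK wmu mu1 t0 phi1).
pose q2 := quadratic_constant qb pb l D N.
have rhs_cvg : (ratio J - k) ^+ 2 + (uniform_constant / n + (t * q2) * (t / J.+1%:R))
    @[J --> \oo] --> uniform_constant / n.
  rewrite -[X in _ --> X]add0r; apply: cvgD.
    have -> : 0 = (k - k) ^+ 2 :> R by rewrite subrr expr0n.
    have H : (ratio J - k) @[J --> \oo] --> k - k by apply: cvgB => //; exact: cvg_cst.
    by rewrite expr2; under eq_fun do rewrite expr2; exact: cvgM.
  rewrite -[X in _ --> X]addr0; apply: cvgD; first exact: cvg_cst.
  exact: time_step_cvg.
apply: (cvgr_to_ge rhs_cvg).
have /cvgrPdist_le/(_ 1 ltr01) c1 := time_step_cvg t (2 * qb + pb + l).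
have /cvgrPdist_le/(_ 1 ltr01) c2 := time_step_cvg t (2 * pb).
near=> J.
have h1 : t / J.+1%:R * (2 * qb + pb + l) <= 1.
  rewrite mulrC; apply: le_trans (ler_norm _) _; rewrite -normrN -sub0r.
  by near: J.
have h2 : t / J.+1%:R * pb <= 1 / 2.
  have : 2 * pb * (t / J.+1%:R) <= 1.
    by apply: le_trans (ler_norm _) _; rewrite -normrN -sub0r; near: J.
  have -> : 2 * pb * (t / J.+1%:R) = 2 * (t / J.+1%:R * pb) by ring.
  by move: (_ * pb) => y; lra.
have e0 : 0 <= t / J.+1%:R by rewrite divr_ge0.
have := square_error_iter Hq N2 pFV e0 h1 h2 phi1 k1 J.+1 eta l0.
rewrite [J.+1%:R * (t / _)]mulrC divfK//.
(* With no evolution left, the denominator is the mean of [1], that is the total mass. *)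
have -> : square_error Q p0 (t / J.+1%:R) k phi 0 (N := N) =
    (fun x => (m x phi - k) ^+ 2).
  apply/funext => x; rewrite /square_error /= (wsum_cst (empirical_weight R x)).
  by rewrite (rsum_empirical R N2) mul1r divr1.
move=> /le_trans; apply; rewrite lerD//; last first.
  rewrite lerD//.
    have -> : uniform_constant / n = linear_constant qb pb l D / n * (2 / (c * l)).
      by rewrite /uniform_constant mulrAC.
    rewrite ler_piMr//.
      by rewrite mulr_ge0// ?divr_ge0 ?(ltW n0)// mulr_ge0// ltW.
    by rewrite gerBl exprn_ge0// (contraction_ge0 Hq e0 h1 i0).
  by rewrite le_eqVlt; apply/orP; left; apply/eqP; rewrite /q2; field.
Unshelve. all: by end_near. Qed.

Lemma fleming_viot_error :
  semigroup p t (fun x => `|mean (empirical R x) phi -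
      conditioned pK (empirical R eta) t phi|) eta
  <= (uniform_constant + 1) / n `^ 2^-1.
Proof.
have wmu := @empirical_weight R F N eta.
have mu1 := @rsum_empirical R F N N2 eta.
have n0 : 0 < n by rewrite ltr0n (leq_trans _ N2).
rewrite powR12_sqrt ?(ltW n0)//; set s := Num.sqrt n.
have s0 : 0 < s by rewrite sqrtr_gt0.
have s2 : s ^+ 2 = n by rewrite sqr_sqrtr// ltW.
have tp := pFV.1.
have sq := fleming_viot_square_error.
set k := conditioned _ _ _ _ in sq *.
have k1 : `|k| <= 1 by exact: (conditioned_norm Hq hK wmu mu1 t0 phi1).
pose g (x : config F N) := m x phi - k.
have bg : bounded g.
  exists 2 => x; rewrite (le_trans (ler_normB _ _))// (natrD _ 1 1) lerD//.
  exact: (mean_norm (empirical_weight R x) (rsum_empirical R N2 x)).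
have bg2 : bounded (fun x => g x ^+ 2) by exact: boundedM.
have bs : bounded (fun x => s * g x ^+ 2) by exact: boundedZ.
have bng : bounded (fun x => `|g x|).
  by have [B gB] := bg; exists B => x; rewrite normr_id.
(* [|x| <= s x^2 + 1 / s] with [s = sqrt N] replaces the Cauchy-Schwarz inequality *)
have H x : `|g x| <= s * g x ^+ 2 - - s^-1.
  rewrite opprK -(real_normK (num_real (g x))); set y := `|g x|.
  have E : s * y ^+ 2 + s^-1 - 2 * y = s^-1 * (s * y - 1) ^+ 2.
    by field; rewrite gt_eqF.
  have : 0 <= s^-1 * (s * y - 1) ^+ 2 by rewrite mulr_ge0 ?sqr_ge0// invr_ge0 ltW.
  by rewrite -E; have : 0 <= y := normr_ge0 _; lra.
rewrite (_ : (fun x => _) = (fun x => `|g x|)); last first.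
  by apply/funext => x; rewrite meanE.
apply: le_trans (ler_semigroup tp eta t0 bng (boundedB bs (@bounded_cst R _ (- s^-1))) H) _.
rewrite semigroupB// semigroup_cst// semigroupZ// opprK.
apply: le_trans (lerD (ler_wpM2l (ltW s0) sq) (lexx _)) _.
by rewrite -s2 le_eqVlt; apply/orP; left; apply/eqP; field; rewrite gt_eqF.
Qed.

End uniform_bound.

Theorem corollary1p5 (R : realType) (F : countType)
    (Q : F -> F -> R) (p0 : F -> R)
    (p : R -> option F -> option F -> R)
    (Q_rates : irreducible_positive_recurrent_rates Q)
    (p0_ge0 : forall i, 0 <= p0 i)
    (p0_neq0 : exists i, p0 i != 0)
    (* [p] gives the semigroup [(P_t)] on [F] with the cemetery added *)
    (p_killed : transition_function_of (killed_generator Q p0) p)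
    (rho_gt0 : (0 < lambda Q - (sup_rate p0 - inf_rate p0))%E)
    (Q_bounded : (ereal_sup (range (exit_rate Q)) < +oo)%E)
    (p0_bounded : (sup_rate p0 < +oo)%E) :
  exists K0 gamma : R, [/\ 0 < K0, 0 < gamma &
    forall N : nat, (2 <= N)%N -> forall eta : config F N,
    forall (d : measure_display) (W : measurableType d) (P : probability W R)
           (X : R -> W -> config F N),
      fleming_viot Q p0 P X -> starts_at P X eta ->
      (ereal_sup [set
         ereal_sup [set
           'E_P[fun w => `|mean (empirical R (X t w)) phi
                           - conditioned p (empirical R eta) t phi|%R]
         | phi in [set phi : F -> R | forall i, `|phi i| <= 1]%R]
       | t in [set t : R | 0 <= t]%R]
       <= (K0 / N%:R `^ gamma)%:E)%E].
Proof.
have [i0 _] := p0_neq0.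
have [qb [pb [l [D Hq]]]] := coalescing_rates_offdiag i0 Q_rates.1 p0_ge0 rho_gt0
  Q_bounded p0_bounded.
(* The [+ 1] is the contribution of [1 / sqrt N] in [fleming_viot_error]; with the absolute value it
   also gives positivity at once. *)
exists (`|uniform_constant qb pb l D| + 1), 2^-1; split => //.
move=> N N2 eta d W P X [pN hN mX] X0.
apply: ge_ereal_sup => _ [t t0 <-]; apply: ge_ereal_sup => _ [phi phi1 <-].
pose k := conditioned p (empirical R eta) t phi.
have bk : bounded (fun x : config F N => mean (empirical R x) phi - k).
  apply: boundedB => //; exists 1 => x; rewrite meanE.
  exact: (mean_norm (empirical_weight R x) (rsum_empirical R N2 x)).
rewrite (expectation_semigroup hN.1 mX X0 (g := fun x => `|mean (empirical R x) phi - k|))//.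
  rewrite lee_fin; apply: le_trans (fleming_viot_error Hq p_killed N2 hN eta t0 phi1) _.
  by rewrite ler_wpM2r ?invr_ge0 ?powR_ge0// lerD// ler_norm.
by have [B kB] := bk; exists B => x; rewrite normr_id.
Qed.
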